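(* Consider the triangular array $Y_{n,k}=\mu+\delta_n\mathbf{1}\{k>\tau_n\}+\sigma(k/n)\varepsilon_k$, $k=1,\dots,n$, and suppose Assumptions E, V and C (stated in the context) hold. Under the alternative hypothesis $\mathcal{H}_1$ with $\tau_n=[n\zeta]$ for some $\zeta\in(0,1)$, $$\mathscr{Q}(V_n)\xrightarrow{P}\infty\quad\text{and}\quad\mathscr{R}(V_n)\xrightarrow{P}\infty,\qquad n\to\infty.$$
   Context: Model: for each $n$, $Y_{n,k}=\mu+\delta_n\mathbf{1}\{k>\tau_n\}+\sigma(k/n)\varepsilon_k$, $k=1,\dots,n$, with unknown constants $\mu\in\mathbb{R}$, $\delta_n\in\mathbb{R}$, $\tau_n\in\{1,\dots,n\}$, a strictly stationary centered sequence $\{\varepsilon_k\}$, and a deterministic $\sigma:[0,1]\to(0,\infty)$. Alternative $\mathcal{H}_1:\tau_n<n,\ \delta_n\neq0$. $[x]$ is the integer part. Strong mixing coefficients: $\alpha(n)=\sup_{k}\sup_{A\in\sigma(\varepsilon_1,\dots,\varepsilon_k),B\in\sigma(\varepsilon_{k+n},\varepsilon_{k+n+1},\dots)}|P(A\cap B)-P(A)P(B)|$. Assumption E: $\{\varepsilon_n\}$ is zero-mean strictly stationary $\alpha$-mixing, $\operatorname{Var}\varepsilon_n=1$, $E|\varepsilon_n|^p<\infty$ for some $p>2$, $\sum_n\alpha(n)^{2(1/r-1/p)}<\infty$ for some $r\in(2,4]$, $r\le p$, $\sum_n n\alpha(n)<\infty$, and $0<1+2\sum_{n\ge1}E\varepsilon_1\varepsilon_{n+1}<\infty$.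 Assumption V: $\sigma:[0,1]\to\mathbb{R}^+$ has finitely many discontinuity points and satisfies a first-order Lipschitz condition except at discontinuity points. Assumption C: $|\delta_n|\sqrt n\to\infty$. Statistics: $V_n(k)=\sum_{i=1}^kY_{n,i}$, $\widetilde V_n(k)=V_n(n)-V_n(k)$, $\mathscr{Q}(V_n)=\max_{1\le k\le n}\left|\frac{V_n(k)-\frac knV_n(n)}{\max_{1\le i\le k}|V_n(i)-\frac ikV_n(k)|+\max_{k<i\le n}|\widetilde V_n(i)-\frac{n-i}{n-k}\widetilde V_n(k)|}\right|$, $\mathscr{R}(V_n)=\sum_{k=1}^n\frac{\{V_n(k)-\frac knV_n(n)\}^2}{\sum_{i=1}^k\{V_n(i)-\frac ikV_n(k)\}^2+\sum_{i=k+1}^n\{\widetilde V_n(i)-\frac{n-i}{n-k}\widetilde V_n(k)\}^2}$. *)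

(* Defs.v *)
From HB Require Import structures.
From mathcomp Require Import all_boot all_order all_algebra.
From mathcomp Require Import all_classical all_reals all_analysis.
Set Implicit Arguments. Unset Strict Implicit. Unset Printing Implicit Defensive.
Import Order.TTheory GRing.Theory Num.Theory.
Import numFieldNormedType.Exports.
Local Open Scope classical_set_scope.
Local Open Scope ring_scope.

(* The innovations eps_k are indexed by k >= 1 (eps 0 is never used). *)
Section defs.
Context {d : measure_display} {T : measurableType d} {R : realType}.
Variable P : probability T R.
Variable eps : nat -> T -> R.

Definition sigma_gen (I : set nat) : set (set T) :=
  <<s [set: T], \bigcup_(i in I) preimage_set_system [set: T] (eps i) measurable >>.

Definition alpha_mix (n : nat) : R :=
  sup [set x : R | exists k : nat, (1 <= k)%N /\
        exists A B : set T,
          sigma_gen [set i | (1 <= i <= k)%N] A /\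
          sigma_gen [set i | (k + n <= i)%N] B /\
          x = `| fine (P (A `&` B)) - fine (P A) * fine (P B) | ].

(* strict stationarity of {eps_k}_{k>=1}: all finite dimensional
   distributions are shift invariant (checked on measurable rectangles,
   which determine the joint laws) *)
Definition strictly_stationary : Prop :=
  forall (m h : nat) (B : nat -> set R), (forall i, measurable (B i)) ->
    P (\bigcap_(i in [set j | (j < m)%N]) (eps (i + 1 + h) @^-1` B i)) =
    P (\bigcap_(i in [set j | (j < m)%N]) (eps (i + 1) @^-1` B i)).

Definition AssumptionE : Prop :=
  (forall k, measurable_fun [set: T] (eps k)) /\
  strictly_stationary /\
  (forall k, (1 <= k)%N -> ('E_P[eps k] = 0)%E) /\
  (forall k, (1 <= k)%N -> 'V_P[eps k] = 1%E) /\
  (exists p r : R, 2 < p /\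
     (forall k, (1 <= k)%N -> (\int[P]_w ((`|eps k w| `^ p)%:E) < +oo)%E) /\
     2 < r /\ r <= 4 /\ r <= p /\
     cvgn (series (fun n => alpha_mix n.+1 `^ (2 * (r^-1 - p^-1))))) /\
  cvgn (series (fun n => n.+1%:R * alpha_mix n.+1)) /\
  (exists s : R,
     series (fun j => fine ('E_P[eps 1 \* eps j.+2])%E) @ \oo --> s /\
     0 < 1 + 2 * s).
End defs.

(* Assumption V: sigma positive on [0,1], with finitely many discontinuity
   points (the finite list D) and Lipschitz on each piece between them. *)
Definition AssumptionV {R : realType} (sig : R -> R) : Prop :=
  (forall x, 0 <= x <= 1 -> 0 < sig x) /\
  exists (D : seq R) (L : R),
    (forall t, t \in D -> 0 <= t <= 1) /\
    forall x y, 0 <= x <= 1 -> 0 <= y <= 1 ->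
      (forall t, t \in D -> ~~ (Num.min x y <= t <= Num.max x y)) ->
      `|sig x - sig y| <= L * `|x - y|.

Definition AssumptionC {R : realType} (delta : nat -> R) : Prop :=
  (fun n : nat => `|delta n| * Num.sqrt n%:R) @ \oo --> +oo.

Definition Ymodel {T : Type} {R : realType} (mu : R) (delta : nat -> R)
  (tau : nat -> nat) (sig : R -> R) (eps : nat -> T -> R) (n k : nat) (w : T) : R :=
  mu + delta n * (tau n < k)%N%:R + sig (k%:R / n%:R) * eps k w.

Section stats.
Context {R : realType}.
Variable Y : nat -> R.  (* Y k = Y_{n,k}, k = 1..n *)
Variable n : nat.

Definition Vn (k : nat) : R := \sum_(1 <= i < k.+1) Y i.
Definition Vtn (k : nat) : R := Vn n - Vn k.

(* empty maxima are 0; x / 0 = 0 by MathComp convention *)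
Definition Qstat : R :=
  \big[Num.max/0]_(1 <= k < n.+1)
    `| (Vn k - k%:R / n%:R * Vn n) /
       (\big[Num.max/0]_(1 <= i < k.+1) `|Vn i - i%:R / k%:R * Vn k|
        + \big[Num.max/0]_(k.+1 <= i < n.+1)
              `|Vtn i - (n - i)%:R / (n - k)%:R * Vtn k|) |.

Definition Rstat : R :=
  \sum_(1 <= k < n.+1)
    (Vn k - k%:R / n%:R * Vn n) ^+ 2 /
    (\sum_(1 <= i < k.+1) (Vn i - i%:R / k%:R * Vn k) ^+ 2
     + \sum_(k.+1 <= i < n.+1) (Vtn i - (n - i)%:R / (n - k)%:R * Vtn k) ^+ 2).
End stats.

Definition cvg_prob_infty {d : measure_display} {T : measurableType d} {R : realType}
  (P : probability T R) (X : nat -> T -> R) : Prop :=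
  forall M : R, (fun n => P [set w | X n w <= M]) @ \oo --> 0%E.

(* Main.v *)
(* At the true change point k = tau_n the level shift cancels from the
   denominators, which therefore only involve the partial sums
   S_k = sum_(i <= k) sigma(i/n) eps_i, while the numerator contains the drift
   |delta_n| tau_n (n - tau_n) / n of order |delta_n| n >> sqrt n. For Q this
   term of the maximum suffices. For R one sums over the
   J = sqrt n / |delta_n| indices following tau_n: there the misplaced change
   point contributes at most |delta_n| J <= sqrt n to each deviation in the
   denominator, so every summand is of order |delta_n|^2 and the sum of order
   |delta_n| sqrt n. The denominators vanish, which would make the quotients 0,
   only if sigma(i/n) eps_i is constant for i <= tau_n; then all these eps_i
   have the same sign, which by mixing has vanishing probability.

   It remains to see that max_k |S_k| / sqrt n is tight. Since sigma has bounded
   variation, summation by parts reduces this to W_k = sum_(i <= k) eps_i.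
   Convergence of the sum of the covariances gives E (W_b - W_a)^2 = O(b - a),
   and an Ottaviani argument over blocks of length m bounds
   P(max_k |W_k| > 4 x) by O(n / x^2) + (n/m) (alpha(m) + O((m/x)^p)).
   With x = a sqrt n and m = n^((p-2)/(2(p-1))), the last term is O(a^(-p)), and
   (n/m) alpha(m) is of order m^(p/(p-2)) alpha(m), which tends to 0 because the
   summability of alpha(n)^(2(1/r-1/p)) with r > 2 forces
   alpha(m) = O(m^(-1/(2(1/r-1/p)))). *)

Require Import Defs.
From HB Require Import structures.
From mathcomp Require Import all_boot all_order all_algebra.
From mathcomp Require Import all_classical all_reals all_analysis.
From mathcomp Require Import measurable_realfun.
From mathcomp Require Import ring lra zify.
Import Order.TTheory GRing.Theory Num.Theory.
Import numFieldNormedType.Exports.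
Local Open Scope classical_set_scope.
Local Open Scope ring_scope.

(** * Weighted partial sums *)

(** Induction on [D]: two points on the same side of [t] are never separated by [t], so each side
    falls under the induction hypothesis, and [t] itself adds a single value. The set [I] is
    arbitrary so that it can shrink. *)
Lemma piecewise_lipschitz_bounded {R : realType} (f : R -> R) (D : seq R) (L : R)
    (I : set R) :
  (forall x, I x -> 0 <= x <= 1) ->
  (forall x y, I x -> I y ->
    (forall t, t \in D -> ~~ (Num.min x y <= t <= Num.max x y)) ->
    `|f x - f y| <= L * `|x - y|) ->
  exists B, forall x, I x -> `|f x| <= B.
Proof.
elim: D I => [|t D IH] I I01 lipf.
  have [[x0 Ix0]|I0] := pselect (exists x, I x); last first.
    by exists 0 => x Ix; case: I0; exists x.
  exists (`|f x0| + `|L|) => x Ix.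
  have /andP[x00 x01] := I01 _ Ix0; have /andP[x0' x1] := I01 _ Ix.
  have h : `|f x - f x0| <= `|L|.
    apply: (le_trans (lipf _ _ Ix Ix0 _)) => //.
    apply: (@le_trans _ _ (`|L| * `|x - x0|)).
      by apply: ler_wpM2r => //; exact: ler_norm.
    rewrite -[leRHS]mulr1 ler_wpM2l// ler_norml; lra.
  rewrite (_ : f x = f x0 + (f x - f x0)); last by ring.
  by rewrite (le_trans (ler_normD _ _))// lerD.
have [|x y [Ix xt] [Iy yt] h|B1 hB1] := IH (I `&` [set x | x < t]).
- by move=> x [/I01].
- apply: lipf => // u; rewrite inE => /orP[/eqP->|/h//].
  by rewrite negb_and -!ltNge orbC gt_max xt yt.
have [|x y [Ix xt] [Iy yt] h|B2 hB2] := IH (I `&` [set x | t < x]).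
- by move=> x [/I01].
- apply: lipf => // u; rewrite inE => /orP[/eqP->|/h//].
  by rewrite negb_and -!ltNge lt_min xt yt.
exists (`|B1| + `|B2| + `|f t|) => x Ix.
have := normr_ge0 B1; have := normr_ge0 B2; have := normr_ge0 (f t).
have := ler_norm B1; have := ler_norm B2.
have [xt|xt|->] := ltgtP x t; last lra.
- have := hB1 _ (conj Ix xt); lra.
- have := hB2 _ (conj Ix xt); lra.
Qed.

(* A jump at [t] in [[x, y]] is charged to the increment over [[x, y]] of
   [(t < _) + (t <= _)]; both strict and large inequalities are needed since
   [t] may be either end point. *)
Lemma AssumptionV_bounded_variation {R : realType} (sig : R -> R) :
  AssumptionV sig -> exists (G : R -> R) (B : R),
    (forall x : R, 0 <= x <= 1 -> `|sig x| <= B) /\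
    (forall x y : R, 0 <= x -> x <= y -> y <= 1 -> `|sig y - sig x| <= G y - G x).
Proof.
move=> [_ [D [L [_]]]]; move=> lip.
have [B hB] := @piecewise_lipschitz_bounded R sig D L [set x | 0 <= x <= 1]
  (fun x h => h) lip.
exists (fun x => `|L| * x + \sum_(t <- D) (2 * B) * ((t < x)%R%:R + (t <= x)%R%:R)), B.
split => // x y x0 xy y1.
have Ix : 0 <= x <= 1 by lra.
have Iy : 0 <= y <= 1 by lra.
have B0 : 0 <= B by apply: le_trans (hB _ Ix).
move: xy; rewrite le_eqVlt => /predU1P[->|xy]; first by rewrite !subrr normr0.
have -> : forall a b c d : R, a + b - (c + d) = (a - c) + (b - d) by move=> *; ring.
rewrite -mulrBr -sumrB.
under eq_bigr do rewrite -mulrBr.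
have term0 t : (0:R) <= 2 * B * ((t < y)%R%:R + (t <= y)%R%:R - ((t < x)%R%:R + (t <= x)%R%:R)).
  apply: mulr_ge0; first lra.
  by case: (ltgtP t y); case: (ltgtP t x) => //=; lra.
have sum0 s : (0:R) <= \sum_(t <- s)
    2 * B * ((t < y)%R%:R + (t <= y)%R%:R - ((t < x)%R%:R + (t <= x)%R%:R)).
  by apply: sumr_ge0 => t _; exact: term0.
have [/hasP[t tD /andP[xt ty]]|/hasPn noD] := boolP (has (fun t => x <= t <= y) D).
  (* The interval meets [D]: the crude bound [2 * B] is absorbed by the term of the single point
     [t], all the other terms being nonnegative. *)
  have : `|sig y - sig x| <= 2 * B.
    apply: (le_trans (ler_normB _ _)).
    have := hB _ Ix; have := hB _ Iy; lra.
  move=> /le_trans; apply.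
  rewrite (perm_big _ (perm_to_rem tD)) big_cons /=.
  apply: (@le_trans _ _ (2 * B * ((t < y)%R%:R + (t <= y)%R%:R - ((t < x)%R%:R + (t <= x)%R%:R)))).
    rewrite -[leLHS]mulr1; apply: ler_wpM2l; first lra.
    move: xt ty; case: (ltgtP t y) => //=; case: (ltgtP t x) => //=; lra.
  have := sum0 (rem t D).
  have : 0 <= `|L| * (y - x) by apply: mulr_ge0 => //; lra.
  lra.
have := lip x y Ix Iy; rewrite distrC min_l ?max_r ?(ltW xy)// => /(_ noD) h.
have h2 : L * `|x - y| <= `|L| * (y - x).
  rewrite ltr0_norm ?subr_lt0// opprB; apply: ler_wpM2r; first lra.
  exact: ler_norm.
have := sum0 D; lra.
Qed.

(** Summation by parts: up to [s k] times the last partial sum of [e], the weighted sum is a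
    combination of partial sums of [e] with the increments of [s] as coefficients. These are
    dominated by the increments of [g], which telescope. *)
Lemma abel_summation_bound {R : realType} (s e g : nat -> R) (A B : R) (n : nat) :
  (forall k, (1 <= k <= n)%N -> `|s k| <= B) ->
  (forall k, (1 <= k < n)%N -> `|s k.+1 - s k| <= g k.+1 - g k) ->
  (forall k, (1 <= k <= n)%N -> `|\sum_(1 <= i < k.+1) e i| <= A) ->
  forall k, (1 <= k <= n)%N ->
  `|\sum_(1 <= i < k.+1) s i * e i| <= A * (B + (g k - g 1%N)).
Proof.
move=> sB sg eA k /andP[k1 kn].
have A0 : 0 <= A by apply: le_trans (eA 1%N _) => //; lia.
have : `|\sum_(1 <= i < k.+1) s i * e i - s k * \sum_(1 <= i < k.+1) e i|
    <= A * (g k - g 1%N).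
  elim: k k1 kn => // -[_ _ n1|k IH _ kn].
    by rewrite !big_nat1 !subrr normr0 mulr0.
  rewrite [in leLHS]big_nat_recr//= [X in _ - _ * X]big_nat_recr//=.
  rewrite (_ : _ - _ = (\sum_(1 <= i < k.+2) s i * e i -
    s k.+1 * \sum_(1 <= i < k.+2) e i) -
    (s k.+2 - s k.+1) * \sum_(1 <= i < k.+2) e i); last by ring.
  apply: (le_trans (ler_normB _ _)).
  rewrite (_ : A * _ = A * (g k.+1 - g 1%N) + (g k.+2 - g k.+1) * A); last by ring.
  apply: lerD; first by apply: IH => //; lia.
  rewrite normrM; apply: ler_pM => //.
  - by apply: sg; lia.
  - by apply: eA; lia.
move=> h.
rewrite -[X in `|X|](subrK (s k * \sum_(1 <= i < k.+1) e i)).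
apply: (le_trans (ler_normD _ _)); rewrite mulrDr addrC; apply: lerD => //.
rewrite normrM mulrC; apply: ler_pM => //; [apply: eA|apply: sB]; lia.
Qed.

Lemma AssumptionV_weighted_sums {R : realType} (sig : R -> R) :
  AssumptionV sig -> exists2 C : R, 0 < C &
  forall n (e : nat -> R) (A : R),
    (forall k, (1 <= k <= n)%N -> `|\sum_(1 <= i < k.+1) e i| <= A) ->
    forall k, (1 <= k <= n)%N ->
    `|\sum_(1 <= i < k.+1) sig (i%:R / n%:R) * e i| <= C * A.
Proof.
move=> /AssumptionV_bounded_variation[G [B [sB sG]]].
have B0 : 0 <= B by apply: le_trans (sB 0 _) => //; rewrite lexx ler01.
have Gmono (x y : R) : 0 <= x -> x <= y -> y <= 1 -> 0 <= G y - G x.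
  by move=> *; apply: le_trans (sG _ _ _ _ _).
have G01 := Gmono 0 1 (lexx _) ler01 (lexx _).
(* [B] bounds the last weight and [G 1 - G 0] the variation along every grid, so the constant does
   not depend on [n]; the summand 1 makes it positive. *)
exists (1 + B + (G 1 - G 0)); first by lra.
move=> n e A eA k kn.
have n0 : (0 < n)%N by lia.
have n0' : 0 < n%:R :> R by rewrite ltr0n.
have frac j : (j <= n)%N -> 0 <= (j%:R / n%:R : R) <= 1.
  by move=> jn; rewrite divr_ge0//= ler_pdivrMr// mul1r ler_nat.
have A0 : 0 <= A by apply: le_trans (eA 1%N _) => //; lia.
apply: le_trans.
  apply: (@abel_summation_bound R (fun i => sig (i%:R / n%:R)) e
    (fun i => G (i%:R / n%:R)) A B n) => //.
    by move=> j /andP[_ jn]; apply/sB/frac.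
  move=> j /andP[j1 jn].
  have /andP[j0 _] := frac _ (ltnW jn); have /andP[_ j1'] := frac _ jn.
  by apply: sG => //; rewrite ler_pM2r ?invr_gt0// ler_nat.
rewrite mulrC; apply: ler_wpM2r => //.
have /andP[k1 kn'] := kn.
have /andP[k0 k1'] := frac _ kn'; have /andP[j0 j1'] := frac _ n0.
have := Gmono _ _ k0 k1' (lexx _); have := Gmono _ _ (lexx 0) j0 j1'.
lra.
Qed.

(** * The statistics of a shifted sequence *)

Section change_point_statistics.
Context {R : realType} (mu dl : R) (tau n : nat) (y : nat -> R).
Let Y k := mu + dl * (tau < k)%N%:R + y k.
Let S k := \sum_(1 <= i < k.+1) y i.

Lemma Vn_changeE k : Vn Y k = k%:R * mu + dl * (k - tau)%N%:R + S k.
Proof.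
rewrite /Vn /S; elim: k => [|k IH].
  by rewrite !big_nil mul0r sub0n mulr0 !addr0.
rewrite big_nat_recr//= [in RHS]big_nat_recr//= IH /Y.
case: (ltnP tau k.+1) => h.
  rewrite subSn// -(natr1 k) -(natr1 (k - tau)%N) /=; ring.
have -> : (k - tau = 0)%N by lia.
have -> : (k.+1 - tau = 0)%N by lia.
rewrite -(natr1 k) /= ; ring.
Qed.

(** From [tau] on, the drift (k - tau) - (k/n)(n - tau) simplifies to -tau(n - k)/n. *)
Lemma Vn_bridgeE k : (tau <= k <= n)%N -> (0 < n)%N ->
  Vn Y k - k%:R / n%:R * Vn Y n =
  S k - k%:R / n%:R * S n - dl * (tau%:R * (n - k)%N%:R / n%:R).
Proof.
move=> /andP[tk kn] n0; rewrite !Vn_changeE !natrB//; last exact: leq_trans kn.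
have nz : n%:R != 0 :> R by rewrite pnatr_eq0 -lt0n.
by field.
Qed.

Variable A : R.
Hypothesis SA : forall k, (1 <= k <= n)%N -> `|S k| <= A.

Let scaledS (a b k : nat) : (a <= b)%N -> (1 <= k <= n)%N -> `|a%:R / b%:R * S k| <= A.
Proof.
move=> ab kn; have A0 : 0 <= A := le_trans (normr_ge0 _) (SA _ kn).
have [b0|b0] := posnP b; first by rewrite b0 invr0 mulr0 mul0r normr0.
rewrite normrM -[leRHS]mul1r ler_pM ?SA// ger0_norm ?divr_ge0//.
by rewrite ler_pdivrMr ?ltr0n// mul1r ler_nat.
Qed.

Lemma Vn_bridge_ge k : (1 <= tau <= k)%N -> (k <= n)%N ->
  `|dl| * (tau%:R * (n - k)%N%:R / n%:R) - 2 * A <= `|Vn Y k - k%:R / n%:R * Vn Y n|.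
Proof.
move=> /andP[t1 tk] kn; have n0 : (0 < n)%N by lia.
rewrite Vn_bridgeE ?tk// distrC.
apply: le_trans (lerB_dist _ _); rewrite normrM [`|_ / _|]ger0_norm; last first.
  by rewrite divr_ge0// mulr_ge0.
rewrite lerD2l lerN2 (le_trans (ler_normB _ _))//.
have := scaledS k n n kn; have := @SA k.
rewrite kn (leq_trans t1 tk) n0 leqnn => /(_ isT) + /(_ isT); lra.
Qed.

(** The drift is [dl] times a difference of two numbers in [0, k - tau]; in particular it vanishes
    at k = tau. *)
Lemma left_bridge_le k i : (tau <= k <= n)%N -> (1 <= i <= k)%N ->
  `|Vn Y i - i%:R / k%:R * Vn Y k| <= 2 * A + `|dl| * (k - tau)%N%:R.
Proof.
move=> /andP[tk kn] /andP[i1 ik].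
have k0 : k%:R != 0 :> R by rewrite pnatr_eq0; lia.
have -> : Vn Y i - i%:R / k%:R * Vn Y k = S i - i%:R / k%:R * S k +
    dl * ((i - tau)%N%:R - i%:R / k%:R * (k - tau)%N%:R).
  by rewrite !Vn_changeE; field.
apply: (le_trans (ler_normD _ _)); apply: lerD.
  apply: (le_trans (ler_normB _ _)).
  have h1 : `|S i| <= A by apply: SA; lia.
  have h2 : `|i%:R / k%:R * S k| <= A by apply: scaledS => //; lia.
  lra.
rewrite normrM; apply: ler_wpM2l => //.
have h1 : (i - tau)%N%:R <= (k - tau)%N%:R :> R by rewrite ler_nat; lia.
have h2 : i%:R / k%:R * (k - tau)%N%:R <= (k - tau)%N%:R :> R.
  rewrite -[leRHS]mul1r ler_wpM2r// ler_pdivrMr ?mul1r ?ler_nat// ltr0n; lia.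
have h3 : 0 <= i%:R / k%:R * (k - tau)%N%:R :> R by rewrite mulr_ge0 ?divr_ge0.
have h4 : 0 <= (i - tau)%N%:R :> R by [].
rewrite ler_norml; lra.
Qed.

(** Past the change point the drift of [Vtn] is proportional to n - i and cancels exactly, leaving
    four noise terms. *)
Lemma right_bridge_le k i : (tau <= k)%N -> (1 <= k < i)%N -> (i <= n)%N ->
  `|Vtn Y n i - (n - i)%N%:R / (n - k)%N%:R * Vtn Y n k| <= 4 * A.
Proof.
move=> tk /andP[k1 ki] im.
have nk0 : (n - k)%N%:R != 0 :> R by rewrite pnatr_eq0; lia.
have kn : (k <= n)%N by lia.
have tin : (tau <= i)%N by lia.
have tnn : (tau <= n)%N by lia.
have -> : Vtn Y n i - (n - i)%N%:R / (n - k)%N%:R * Vtn Y n k =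
    (S n - S i) - ((n - i)%N%:R / (n - k)%N%:R * S n - (n - i)%N%:R / (n - k)%N%:R * S k).
  rewrite /Vtn !Vn_changeE; move: nk0; rewrite !natrB// => nk0; by field.
have h1 : `|S n| <= A by apply: SA; lia.
have h2 : `|S i| <= A by apply: SA; lia.
have h3 : `|(n - i)%N%:R / (n - k)%N%:R * S n| <= A by apply: scaledS; lia.
have h4 : `|(n - i)%N%:R / (n - k)%N%:R * S k| <= A by apply: scaledS; lia.
apply: (le_trans (ler_normB _ _)).
have := ler_normB (S n) (S i).
have := ler_normB ((n - i)%N%:R / (n - k)%N%:R * S n) ((n - i)%N%:R / (n - k)%N%:R * S k).
lra.
Qed.

(* If all left deviations at [k] vanish, [Y] is constant up to [k]. *)
Lemma left_bridge_neq0 k : (tau <= k)%N ->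
  (exists2 i, (1 <= i <= tau)%N & y i != y 1%N) ->
  exists2 i, (1 <= i <= k)%N & Vn Y i - i%:R / k%:R * Vn Y k != 0.
Proof.
move=> tk [i /andP[i1 it] yi]; apply: contrapT => no.
have VE j : (j <= k)%N -> Vn Y j = j%:R * (Vn Y k / k%:R).
  move=> jk; have [->|j0] := posnP j; first by rewrite /Vn big_nil mul0r.
  apply: contrapT => /eqP; rewrite -subr_eq0 => h; apply: no.
  exists j; first by rewrite j0.
  by rewrite mulrAC -mulrA.
have YE j : (1 <= j <= tau)%N -> mu + y j = Vn Y k / k%:R.
  case: j => // j /andP[_ jt].
  have h1 := VE j.+1 (leq_trans jt tk).
  have h0 := VE j (leq_trans (ltnW jt) tk).
  have hV : Vn Y j.+1 = Vn Y j + Y j.+1 by rewrite /Vn big_nat_recr.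
  have <- : Y j.+1 = mu + y j.+1 by rewrite /Y ltnNge jt/= mulr0 addr0.
  by apply: (addrI (Vn Y j)); rewrite -hV h1 h0 -natr1 mulrDl mul1r.
move/eqP: yi; apply; apply: (addrI mu); rewrite !YE//; lia.
Qed.

Hypothesis tau1n : (1 <= tau < n)%N.
Hypothesis nondeg : exists2 i, (1 <= i <= tau)%N & y i != y 1%N.

(** At k = tau the numerator loses at most [2 * A] to the noise, and the two maxima below are at
    most [2 * A] and [4 * A], whence 6M + 2. By [nondeg] the denominator is positive, so the
    quotient is not the default 0. *)
Lemma Qstat_gt (M : R) : 0 <= M ->
  (6 * M + 2) * A < `|dl| * (tau%:R * (n - tau)%N%:R / n%:R) -> M < Qstat Y n.
Proof.
move=> M0 hA; have /andP[t1 tn] := tau1n.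
have A0 : 0 <= A.
  by apply: le_trans (@SA tau _) => //; rewrite t1 ltnW.
rewrite /Qstat.
have taun : tau \in index_iota 1 n.+1 by rewrite mem_index_iota t1 ltnS ltnW.
apply: (lt_le_trans _ (le_bigmax_seq 0 tau predT _ taun isT)).
set a := \big[Num.max/0]_(1 <= i < tau.+1) _.
set b := \big[Num.max/0]_(tau.+1 <= i < n.+1) _.
have b0 : 0 <= b by exact: bigmax_ge_id.
have a0 : 0 < a.
  have [i it Vi] := left_bridge_neq0 _ (leqnn tau) nondeg.
  have ii : i \in index_iota 1 tau.+1 by rewrite mem_index_iota ltnS.
  by apply: (lt_le_trans _ (le_bigmax_seq 0 i predT _ ii isT)); rewrite normr_gt0; exact: Vi.
have aA : a <= 2 * A.
  rewrite /a big_seq; apply: bigmax_le; first lra.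
  move=> i; rewrite mem_index_iota ltnS => it.
  by have := @left_bridge_le tau i; rewrite leqnn ltnW// subnn mulr0 addr0; exact.
have bA : b <= 4 * A.
  rewrite /b big_seq; apply: bigmax_le; first lra.
  by move=> i; rewrite mem_index_iota ltnS => /andP[ti im]; apply: right_bridge_le; rewrite ?t1.
rewrite normrM normfV [`|a + b|]gtr0_norm; last lra.
rewrite ltr_pdivlMr; last lra.
have := @Vn_bridge_ge tau; rewrite leqnn t1 ltnW// => /(_ isT isT).
apply: lt_le_trans.
have : M * (a + b) <= M * (6 * A) by apply: ler_wpM2l => //; lra.
lra.
Qed.

(* In the denominators at [tau, ..., tau + J], [4 * A] bounds the noise and [E]
   the drift caused by the misplaced change point. *)
Lemma Rstat_ge (J : nat) (b E : R) : (tau + J < n)%N -> 0 <= b ->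
  `|dl| * J%:R <= E ->
  (forall k, (tau <= k <= tau + J)%N ->
    b + 2 * A <= `|dl| * (tau%:R * (n - k)%N%:R / n%:R)) ->
  J.+1%:R * (b ^+ 2 / (n%:R * (4 * A + E) ^+ 2)) <= Rstat Y n.
Proof.
move=> tJn b0 JE hb; have /andP[t1 tn] := tau1n.
have A0 : 0 <= A.
  by apply: le_trans (@SA tau _) => //; rewrite t1 ltnW.
have E0 : 0 <= E by apply: le_trans JE; exact: mulr_ge0.
pose den k := \sum_(1 <= i < k.+1) (Vn Y i - i%:R / k%:R * Vn Y k) ^+ 2
     + \sum_(k.+1 <= i < n.+1) (Vtn Y n i - (n - i)%:R / (n - k)%:R * Vtn Y n k) ^+ 2.
pose t k := (Vn Y k - k%:R / n%:R * Vn Y n) ^+ 2 / den k.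
have den0 k : 0 <= den k.
  by rewrite /den addr_ge0// sumr_ge0// => i _; exact: sqr_ge0.
have t0 k : 0 <= t k by rewrite /t divr_ge0// sqr_ge0.
have -> : Rstat Y n = \sum_(1 <= k < n.+1) t k by [].
rewrite (@big_cat_nat _ _ _ tau)//=; last by rewrite ltnW// ltnS ltnW.
rewrite (@big_cat_nat _ _ _ (tau + J.+1) tau)//=; [|exact: leq_addr|by rewrite addnS ltnS ltnW].
apply: ler_wpDl; first by apply: sumr_ge0.
apply: ler_wpDr; first by apply: sumr_ge0.
rewrite -[X in X%:R](addKn tau) mulrC mulr_natr -sumr_const_nat.
apply: ler_sum_nat => k.
rewrite addnS ltnS => /andP[tk kJ].
have kn : (k < n)%N by apply: leq_ltn_trans tJn.
have denp : 0 < den k.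
  have [i ik Vi] := left_bridge_neq0 _ tk nondeg.
  rewrite /den ltr_pwDl//; last by apply: sumr_ge0 => ? _; exact: sqr_ge0.
  rewrite (bigD1_seq i)/= ?iota_uniq ?mem_index_iota ?ltnS//.
  rewrite ltr_pwDl//; last by apply: sumr_ge0 => ? _; exact: sqr_ge0.
  by rewrite exprn_even_gt0.
have sq (x c : R) : `|x| <= c -> x ^+ 2 <= c ^+ 2.
  by move=> xc; rewrite -(real_normK (num_real x)) lerXn2r// ?nnegrE// (le_trans _ xc).
(* There are k left and n - k right deviations, each at most [4 * A + E]. *)
have denle : den k <= n%:R * (4 * A + E) ^+ 2.
  rewrite -{1}(subnKC (ltnW kn)) natrD mulrDl; apply: lerD.
    apply: (@le_trans _ _ (\sum_(1 <= i < k.+1) (4 * A + E) ^+ 2)); last first.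
      by rewrite sumr_const_nat subn1 [leRHS]mulr_natl.
    apply: ler_sum_nat => i.
    rewrite ltnS => ik; apply: sq.
    apply: (le_trans (@left_bridge_le k i _ ik)); first by rewrite tk ltnW.
    have : `|dl| * (k - tau)%N%:R <= `|dl| * J%:R.
      by apply: ler_wpM2l => //; rewrite ler_nat; lia.
    lra.
  apply: (@le_trans _ _ (\sum_(k.+1 <= i < n.+1) (4 * A + E) ^+ 2)); last first.
    by rewrite sumr_const_nat subSS [leRHS]mulr_natl.
  apply: ler_sum_nat => i.
  rewrite ltnS => /andP[ki im]; apply: sq.
  apply: (@le_trans _ _ (4 * A)); last lra.
  by apply: right_bridge_le => //; rewrite ki (leq_trans t1 tk).
have numge : b ^+ 2 <= (Vn Y k - k%:R / n%:R * Vn Y n) ^+ 2.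
  rewrite -[leRHS](real_normK (num_real _)) lerXn2r ?nnegrE//.
  have t1k : (1 <= tau <= k)%N by rewrite t1.
  apply: le_trans (Vn_bridge_ge k t1k (ltnW kn)).
  have tkJ : (tau <= k <= tau + J)%N by rewrite tk.
  by rewrite lerBrDr; exact: hb.
rewrite /t; apply: ler_pM => //; first exact: sqr_ge0.
  by rewrite invr_ge0 (le_trans (ltW denp)).
by rewrite lef_pV2 ?posrE// (lt_le_trans denp).
Qed.

End change_point_statistics.

(** * Measurability and mixing *)

Section measurable_sets.
Context {d : measure_display} {T : measurableType d} {R : realType}.
Implicit Types f g : T -> R.

Lemma measurable_set_ler f g : measurable_fun setT f -> measurable_fun setT g ->
  measurable [set w | f w <= g w].
Proof.
move=> mf mg; have h := measurable_fun_ler mf mg; have := h measurableT [set true] I.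
by rewrite setTI; congr measurable; apply/seteqP; split => w.
Qed.

Lemma measurable_set_ltr f g : measurable_fun setT f -> measurable_fun setT g ->
  measurable [set w | f w < g w].
Proof.
move=> mf mg; have h := measurable_fun_ltr mf mg; have := h measurableT [set true] I.
by rewrite setTI; congr measurable; apply/seteqP; split => w.
Qed.

Lemma measurable_sum_seq (I : eqType) (s : seq I) (h : I -> T -> R) :
  (forall i, i \in s -> measurable_fun setT (h i)) ->
  measurable_fun setT (fun w => \sum_(i <- s) h i w).
Proof.
elim: s => [|i s IH] mh.
  by under eq_fun do rewrite big_nil; exact: measurable_cst.
under eq_fun do rewrite big_cons; apply: measurable_funD.
  by apply: mh; rewrite mem_head.
by apply: IH => j js; apply: mh; rewrite inE js orbT.
Qed.

Lemma measurable_bigmax (I : eqType) (s : seq I) (h : I -> T -> R) :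
  (forall i, i \in s -> measurable_fun setT (h i)) ->
  measurable_fun setT (fun w => \big[Num.max/0]_(i <- s) h i w).
Proof.
elim: s => [|i s IH] mh.
  by under eq_fun do rewrite big_nil; exact: measurable_cst.
under eq_fun do rewrite big_cons; apply: measurable_maxr.
  by apply: mh; rewrite mem_head.
by apply: IH => j js; apply: mh; rewrite inE js orbT.
Qed.

(* Since [0 `^ (-1) = 0^-1 = 0], inversion of a nonnegative function is the power [-1]. *)
Lemma measurable_div_ge0 f g : measurable_fun setT f -> measurable_fun setT g ->
  (forall w, 0 <= g w) -> measurable_fun setT (fun w => f w / g w).
Proof.
move=> mf mg g0; apply: measurable_funM => //.
rewrite (_ : (fun w => (g w)^-1) = (fun w => g w `^ (-1))).
  exact: (measurableT_comp (measurable_powR _)).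

by apply/funext => w; rewrite powR_inv1.
Qed.

End measurable_sets.

Section probability_lemmas.
Context {d : measure_display} {T : measurableType d} {R : realType} (P : probability T R).
Local Notation pr A := (fine (P A)).

Lemma pr_EFin A : measurable A -> P A = (pr A)%:E.
Proof. by move=> mA; rewrite fineK// fin_num_measure. Qed.

Lemma pr_ge0 A : 0 <= pr A.
Proof. exact: fine_ge0. Qed.

Lemma pr_le1 A : measurable A -> pr A <= 1.
Proof. by move=> mA; rewrite -lee_fin -pr_EFin// probability_le1. Qed.

Lemma le_pr A B : measurable A -> measurable B -> A `<=` B -> pr A <= pr B.
Proof.
by move=> mA mB AB; rewrite -lee_fin -!pr_EFin//; apply: le_measure; rewrite ?inE.
Qed.

Lemma pr_setU_le A B : measurable A -> measurable B -> pr (A `|` B) <= pr A + pr B.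
Proof.
move=> mA mB; rewrite -lee_fin EFinD -!pr_EFin//; last exact: measurableU.
exact: measureU2.
Qed.

Lemma pr_bigcup_le (F : nat -> set T) n : (forall i, measurable (F i)) ->
  pr (\bigcup_(i < n) F i) <= \sum_(i < n) pr (F i).
Proof.
move=> mF; rewrite bigcup_mkord; elim: n => [|n IH].
  by rewrite !big_ord0 measure0.
rewrite !big_ord_recr/=; apply: le_trans (lerD IH (lexx _)).
by apply: pr_setU_le => //; exact: bigsetU_measurable.
Qed.

Lemma sum_pr_disjoint_le1 (F : nat -> set T) n : (forall i, measurable (F i)) ->
  trivIset setT F -> \sum_(i < n) pr (F i) <= 1.
Proof.
move=> mF tF; rewrite -lee_fin -sumEFin.
under eq_bigr do rewrite -pr_EFin//.
rewrite -measure_semi_additive_ord//; first last.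
- exact: bigsetU_measurable.
- by move=> i j _ _ h; apply/ord_inj/tF.
- by apply: probability_le1; exact: bigsetU_measurable.
Qed.

Lemma pr_markov (X : T -> R) (c : R) : measurable_fun setT X -> (forall w, 0 <= X w) ->
  (\int[P]_w (X w)%:E < +oo)%E -> 0 < c ->
  pr [set w | c <= X w] <= fine (\int[P]_w (X w)%:E) / c.
Proof.
move=> mX X0 iX c0.
have mE : measurable [set w | c <= X w].
  exact: measurable_set_ler.
have I0 : (0 <= \int[P]_w (X w)%:E)%E by apply: integral_ge0 => w _; rewrite lee_fin.
rewrite ler_pdivlMr// mulrC -lee_fin EFinM -pr_EFin// fineK; last first.
  by rewrite ge0_fin_numE.
have := @le_integral_comp_abse _ _ _ P _ measurableT (EFin \o X) c id
  (@measurable_id _ _ _) (fun r h => h) _ _ c0.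
rewrite setTI.
have -> : [set w | (c%:E <= `|(EFin \o X) w|)%E] = [set w | c <= X w].
  by apply/seteqP; split => w /=; rewrite lee_fin ger0_norm.
under eq_integral do rewrite /= ger0_norm//.
by apply => //; exact/measurable_EFinP.
Qed.

End probability_lemmas.

Section mixing.
Context {d : measure_display} {T : measurableType d} {R : realType} (P : probability T R).
Variable eps : nat -> T -> R.
Hypothesis meps : forall k, measurable_fun setT (eps k).
Local Notation pr A := (fine (P A)).

(** Turning the generated sigma-algebra into a measurable type lets the general measurability lemmas
    prove membership in [sigma_gen]. *)
Definition sigma_gen_type (I : set nat) :=
  g_sigma_algebraType (\bigcup_(i in I) preimage_set_system [set: T] (eps i) measurable).

Lemma sigma_gen_measurable_eps (I : set nat) i : I i ->
  measurable_fun (setT : set (sigma_gen_type I)) (eps i : sigma_gen_type I -> R).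
Proof.
move=> Ii _ A mA; apply: sub_sigma_algebra; exists i => //; exists A => //.
Qed.

Lemma sigma_gen_sub I J : I `<=` J -> sigma_gen eps I `<=` sigma_gen eps J.
Proof. by move=> IJ; apply: sub_sigma_algebra2 => A [i Ii h]; exists i => //; exact: IJ. Qed.

Lemma sigma_gen_measurable I A : sigma_gen eps I A -> measurable A.
Proof.
apply: smallest_sub; first exact: sigma_algebra_measurable.
by move=> B [i _ [C mC <-]]; exact: meps.
Qed.

(** This is the set whose supremum is [alpha_mix]. As [sup] takes a default value on empty or
    unbounded sets, an upper bound and an element are exhibited below. *)
Let mixset n := [set x : R | exists k : nat, (1 <= k)%N /\
        exists A B : set T,
          sigma_gen eps [set i | (1 <= i <= k)%N] A /\
          sigma_gen eps [set i | (k + n <= i)%N] B /\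
          x = `| fine (P (A `&` B)) - fine (P A) * fine (P B) | ].

Let mixset_ub n : ubound (mixset n) 1.
Proof.
move=> x [k [_ [A [B [/sigma_gen_measurable mA [/sigma_gen_measurable mB ->]]]]]].
have := pr_le1 P _ mA; have := pr_le1 P _ mB; have := pr_le1 P _ (measurableI _ _ mA mB).
have := pr_ge0 P A; have := pr_ge0 P B; have := pr_ge0 P (A `&` B).
move=> *; rewrite ler_norml; nra.
Qed.

Lemma alpha_mix_bound n k A B : (1 <= k)%N ->
  sigma_gen eps [set i | (1 <= i <= k)%N] A ->
  sigma_gen eps [set i | (k + n <= i)%N] B ->
  pr (A `&` B) <= pr A * pr B + alpha_mix P eps n.
Proof.
move=> k1 sA sB.
have : `|pr (A `&` B) - pr A * pr B| <= alpha_mix P eps n.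
  apply: ub_le_sup; first by exists 1; exact: mixset_ub.
  by exists k; split => //; exists A, B.
by move/(le_trans (ler_norm _)); lra.
Qed.

Let mixset0 n : mixset n 0.
Proof.
have s0 I : sigma_gen eps I set0.
  by have [] := smallest_sigma_algebra [set: T]
    (\bigcup_(i in I) preimage_set_system [set: T] (eps i) measurable).
exists 1%N; split => //; exists set0, set0; split => //; split => //.
by rewrite setI0 measure0/= mul0r subr0 normr0.
Qed.

Lemma alpha_mix_ge0 n : 0 <= alpha_mix P eps n.
Proof.
by apply: (@ub_le_sup _ (mixset n) _ _ (mixset0 n)); exists 1; exact: mixset_ub.
Qed.

(** A wider gap leaves a smaller sigma-algebra for the future event. *)
Lemma alpha_mix_nonincreasing m n : (m <= n)%N -> alpha_mix P eps n <= alpha_mix P eps m.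
Proof.
move=> mn; apply: ge_sup; first by exists 0; exact: mixset0.
move=> x [k [k1 [A [B [sA [sB xE]]]]]].
apply: ub_le_sup; first by exists 1; exact: mixset_ub.
exists k; split => //; exists A, B; split => //; split => //.
by apply: sigma_gen_sub sB => i /= h; lia.
Qed.

End mixing.

(** * Moments of stationary sequences *)

Section stationary_moments.
Context {d : measure_display} {T : measurableType d} {R : realType} (P : probability T R).
Variable eps : nat -> T -> R.
Hypothesis meps : forall k, measurable_fun setT (eps k).
Hypothesis stat : strictly_stationary P eps.
Local Notation pr A := (fine (P A)).

Lemma stationary_pair h g (A B : set R) : measurable A -> measurable B ->
  P (eps (1 + h) @^-1` A `&` eps (g + 1 + h) @^-1` B) =
  P (eps 1 @^-1` A `&` eps (g + 1) @^-1` B).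
Proof.
move=> mA mB.
(* All coordinates but 0 and [g] are left free; the intersection also covers g = 0, where both
   constraints bear on one coordinate. *)
pose C i := (if i == 0%N then A else setT) `&` (if i == g then B else setT).
have mC i : measurable (C i) by apply: measurableI; case: ifP.
have E k : \bigcap_(i in [set j | (j < g.+1)%N]) (eps (i + 1 + k) @^-1` C i) =
    eps (1 + k) @^-1` A `&` eps (g + 1 + k) @^-1` B.
  apply/seteqP; split => w /=.
    move=> Cw; split.
      by have [] := Cw 0%N isT.
    by have [_] := Cw g (ltnSn g); rewrite eqxx.
  move=> [Aw Bw] i _; rewrite /C; split; case: eqVneq => // ->; [exact: Aw|exact: Bw].
have E0 : \bigcap_(i in [set j | (j < g.+1)%N]) (eps (i + 1) @^-1` C i) =
    eps 1%N @^-1` A `&` eps (g + 1) @^-1` B.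
  by have := E 0%N; rewrite !addn0 => <-; apply: eq_bigcapr => i _; rewrite addn0.
by rewrite -E -E0; exact: stat.
Qed.

(** The two joint laws agree on measurable rectangles, a generating pi-system, hence everywhere; the
    integrals are taken against these pushforwards. *)
Lemma stationary_pair_integral h g (f : R * R -> R) : measurable_fun setT f ->
  P.-integrable setT (fun w => (f (eps (1 + h) w, eps (g + 1 + h) w))%:E) ->
  P.-integrable setT (fun w => (f (eps 1 w, eps (g + 1) w))%:E) ->
  (\int[P]_w (f (eps (1 + h) w, eps (g + 1 + h) w))%:E =
   \int[P]_w (f (eps 1 w, eps (g + 1) w))%:E)%E.
Proof.
move=> mf i1 i2.
pose phi k w := (eps (1 + k) w, eps (g + 1 + k) w).
have mphi k : measurable_fun setT (phi k).
  exact/measurable_fun_pair.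
have mphi0 : measurable_fun setT (fun w => (eps 1 w, eps (g + 1) w)).
  exact/measurable_fun_pair.
have mf' : measurable_fun setT (EFin \o f) by exact/measurable_EFinP.
have := @integral_pushforward _ _ _ _ R _ mphi0 P setT (EFin \o f) mf' i2 measurableT.
rewrite preimage_setT => <-.
have := @integral_pushforward _ _ _ _ R _ (mphi h) P setT (EFin \o f) mf' i1 measurableT.
rewrite preimage_setT => <-.
pose G : set (set (R * R)) := [set A `*` B | A in measurable & B in measurable].
apply: eq_measure_integral => A mA _.
apply: (@measure_unique _ R _ G (fun=> setT)) => //.
- by rewrite measurable_prod_measurableType.
- move=> _ _ [A1 mA1 [B1 mB1 <-]] [A2 mA2 [B2 mB2 <-]].
  rewrite -setXI; exists (A1 `&` A2); first exact: measurableI.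
  by exists (B1 `&` B2) => //; exact: measurableI.
- by move=> _; exists setT => //; exists setT => //; rewrite setXTT.
- by rewrite bigcup_const.
- by move=> _ [A1 mA1 [B1 mB1 <-]]; exact: stationary_pair.
- by move=> _; rewrite /=/pushforward preimage_setT probability_setT ltry.
Qed.

Hypothesis sq : forall k, (1 <= k)%N -> (\int[P]_w (eps k w ^+ 2)%:E)%E = 1%E.

Lemma integrable_eps_mul i j : (1 <= i)%N -> (1 <= j)%N ->
  P.-integrable setT (fun w => (eps i w * eps j w)%:E).
Proof.
have isq k : (1 <= k)%N -> P.-integrable setT (fun w => (eps k w ^+ 2)%:E).
  move=> k1; apply/integrableP; split.
    by apply/measurable_EFinP; exact: measurable_funX.
  under eq_integral do rewrite /= ger0_norm ?sqr_ge0//.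
  by rewrite sq// ltry.
move=> i1 j1; apply: (le_integrable measurableT _ _
  (integrableD measurableT (isq _ i1) (isq _ j1))).
  by apply/measurable_EFinP; exact: measurable_funM.
move=> w _ /=; rewrite lee_fin [leRHS]ger0_norm ?addr_ge0 ?sqr_ge0//.
rewrite ler_norml; apply/andP; split; nra.
Qed.

(** [c j] is the mixed moment at lag j + 1. *)
Let c (j : nat) : R := fine 'E_P[eps 1 \* eps j.+2]%E.

Lemma integral_eps_mul i j : (1 <= i < j)%N ->
  (\int[P]_w (eps i w * eps j w)%:E)%E = (c (j - i).-1)%:E.
Proof.
move=> /andP[i1 ij].
rewrite /c unlock fineK; last by apply: integrable_fin_num => //; exact: integrable_eps_mul.
have := @stationary_pair_integral i.-1 (j - i) (fun xy => xy.1 * xy.2).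
have -> : (1 + i.-1 = i)%N by lia.
have -> : (j - i + 1 + i.-1 = j)%N by lia.
have -> : (j - i + 1 = (j - i).-1.+2)%N by lia.
apply; [|by apply: integrable_eps_mul; lia..].
by apply: measurable_funM; [exact: measurable_fst|exact: measurable_snd].
Qed.

(** The block consists of the indices a + 1, ..., a + l, so a = 0 gives the ordinary partial
    sums. *)
Definition blocksum (a l : nat) (w : T) : R := \sum_(i < l) eps (a + i).+1 w.

Lemma measurable_blocksum a l : measurable_fun setT (blocksum a l).
Proof. by apply: measurable_sum => i; exact: meps. Qed.

(** Appending one variable adds its second moment 1 and twice its mixed moments with the preceding
    ones, at lags 1 to l. Bounded partial sums of [c] thus make the second moment linear in the
    length, uniformly in [a]. *)
Lemma blocksum_variance a l : P.-integrable setT (fun w => (blocksum a l w ^+ 2)%:E) /\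
  (\int[P]_w (blocksum a l w ^+ 2)%:E)%E =
  (\sum_(k < l) (1 + 2 * \sum_(j < k) c j))%:E.
Proof.
elim: l => [|l [IHi IH]].
  rewrite big_ord0; under eq_fun do rewrite /blocksum big_ord0 expr0n/=.
  by split; [exact: integrable0|rewrite integral0].
have icross : P.-integrable setT
    (fun w => (\sum_(i < l) (eps (a + i).+1 w * eps (a + l).+1 w)%:E)%E).
  by apply: integrable_sum => // i _; exact: integrable_eps_mul.
have icross2 := integrableZl measurableT 2 icross.
have i2 := integrable_eps_mul (a + l).+1 (a + l).+1 isT isT.
have -> : (fun w => (blocksum a l.+1 w ^+ 2)%:E) =
    (fun w => (blocksum a l w ^+ 2)%:E +
      (2%:E * (\sum_(i < l) (eps (a + i).+1 w * eps (a + l).+1 w)%:E) +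
       (eps (a + l).+1 w * eps (a + l).+1 w)%:E))%E.
  apply/funext => w; rewrite /blocksum big_ord_recr/= sumEFin -mulr_suml.
  by rewrite -EFinM -!EFinD; congr (_%:E); ring.
split; first by apply: integrableD => //; apply: integrableD.
rewrite integralD//; last exact: integrableD.
rewrite integralD// integralZl// integral_sum//; last by move=> i; exact: integrable_eps_mul.
rewrite IH big_ord_recr/=.
under [X in (_ + (_ * X + _))%E]eq_bigr => i _.
  rewrite integral_eps_mul; last by rewrite !ltnS ltn_add2l ltn_ord.
  over.
under [X in (_ + (_ + X))%E]eq_integral do rewrite -expr2.
rewrite sq// sumEFin -EFinM -!EFinD; congr (_%:E); congr (_ + _).
rewrite addrC; congr (_ + _ * _).
rewrite (reindex_inj rev_ord_inj)/=; apply: eq_bigr => i _; congr c.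
have := ltn_ord i; lia.
Qed.

Lemma blocksum_chebyshev (B : R) : (forall k, `|\sum_(j < k) c j| <= B) ->
  forall a l x, 0 < x -> pr [set w | x <= `|blocksum a l w|] <= (1 + 2 * B) * l%:R / x ^+ 2.
Proof.
move=> cB a l x x0.
have [bi bE] := blocksum_variance a l.
have mb := measurable_blocksum a l.
have -> : [set w | x <= `|blocksum a l w|] = [set w | x ^+ 2 <= blocksum a l w ^+ 2].
  apply/seteqP; split => w /=; rewrite -(real_normK (num_real (blocksum a l w)))
    ler_sqr ?nnegrE//; exact: ltW.
apply: le_trans.
  apply: (pr_markov P (fun w => blocksum a l w ^+ 2)).
  - exact: measurable_funX.
  - by move=> w; exact: sqr_ge0.
  - by rewrite bE ltry.
  - exact: exprn_gt0.
rewrite bE ler_pM2r ?invr_gt0 ?exprn_gt0//=.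
have -> : (1 + 2 * B) * l%:R = \sum_(k < l) (1 + 2 * B).
  by rewrite sumr_const card_ord mulr_natr.
apply: ler_sum => k _.
have := cB k; rewrite ler_norml; lra.
Qed.

Variable p : R.
Hypothesis p1 : 1 < p.
Hypothesis moment : forall k, (1 <= k)%N -> (\int[P]_w ((`|eps k w| `^ p)%:E) < +oo)%E.
Let K : R := fine (\int[P]_w ((`|eps 1 w| `^ p)%:E))%E.

Let mpow k : measurable_fun setT (fun w => `|eps k w| `^ p).
Proof.
apply: (measurableT_comp (measurable_powR _)).
exact: measurableT_comp.
Qed.

Lemma stationary_moment k : (1 <= k)%N -> (\int[P]_w ((`|eps k w| `^ p)%:E))%E = K%:E.
Proof.
move=> k1.
have ip j : (1 <= j)%N -> P.-integrable setT (fun w => (`|eps j w| `^ p)%:E).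
  move=> j1; apply/integrableP; split; first exact/measurable_EFinP.
  under eq_integral do rewrite /= ger0_norm ?powR_ge0//.
  exact: moment.
rewrite /K fineK; last by apply: integrable_fin_num => //; exact: ip.
have := @stationary_pair_integral k.-1 0 (fun xy => `|xy.1| `^ p).
have -> : (1 + k.-1 = k)%N by lia.
apply; [|exact: ip|exact: ip].
apply: (measurableT_comp (measurable_powR _)).
by apply: measurableT_comp => //; exact: measurable_fst.
Qed.

(** This controls the oscillation of the partial sums within a block, all at once. *)
Definition absblock (a m : nat) (w : T) : R := \sum_(i < m) `|eps (a + i).+1 w|.

Lemma measurable_absblock a l : measurable_fun setT (absblock a l).
Proof. by apply: measurable_sum => i; exact: measurableT_comp. Qed.

(** After truncation at q = x/(2m) the small parts total at most x/2, so the p-th powers must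
    account for the remaining x/2 = mq. Markov's inequality then gives mK/(q^(p-1) mq), where m
    cancels. *)
Lemma absblock_tail a m x : (0 < m)%N -> 0 < x ->
  pr [set w | x < absblock a m w] <= K / (x / (2 * m%:R)) `^ p.
Proof.
move=> m0 x0; have [q qE] : exists q, q = x / (2 * m%:R) by eexists.
rewrite -qE.
have m0' : 0 < m%:R :> R by rewrite ltr0n.
have q0 : 0 < q by rewrite qE divr_gt0// mulr_gt0.
have qp0 := powR_gt0 (p - 1) q0.
have q1 : q `^ p = q * q `^ (p - 1).
  by rewrite -{2}(powRr1 (ltW q0)) -powRD ?(gt_eqF q0) ?implybT//; congr (_ `^ _); ring.
(* [|y| <= q + |y|^p / q^(p-1)] truncates at the level [q = x / (2 m)]. *)
have trunc y : `|y| <= q + `|y| `^ p / q `^ (p - 1).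
  have [yq|qy] := leP `|y| q.
    by apply: ler_wpDr => //; rewrite divr_ge0 ?powR_ge0.
  apply: ler_wpDl; first exact: ltW.
  have y0 : 0 < `|y| by exact: lt_trans qy.
  rewrite ler_pdivlMr//.
  have -> : `|y| `^ p = `|y| * `|y| `^ (p - 1).
    by rewrite -{2}(powRr1 (ltW y0)) -powRD ?(gt_eqF y0) ?implybT//; congr (_ `^ _); ring.
  apply: ler_wpM2l => //; apply: ge0_ler_powR; rewrite ?nnegrE ?subr_ge0; exact: ltW.
pose S w := \sum_(i < m) `|eps (a + i).+1 w| `^ p.
have mS : measurable_fun setT S by apply: measurable_sum.
have IS : (\int[P]_w (S w)%:E)%E = (m%:R * K)%:E.
  under eq_integral do rewrite /S -sumEFin.
  rewrite ge0_integral_sum//.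
  - under eq_bigr do rewrite stationary_moment//.
    by rewrite sumEFin sumr_const card_ord mulr_natl.
  - by move=> i; exact/measurable_EFinP.
apply: (@le_trans _ _ (pr [set w | q `^ (p - 1) * (x / 2) <= S w])).
  apply: le_pr.
  - by apply: measurable_set_ltr => //; exact: measurable_absblock.
  - exact: measurable_set_ler.
  - move=> w /= xZ.
    have : absblock a m w <= \sum_(i < m) (q + `|eps (a + i).+1 w| `^ p / q `^ (p - 1)).
      by apply: ler_sum.
    rewrite big_split/= -mulr_suml.
    have -> : \sum_(i < m) q = x / 2.
      by rewrite sumr_const card_ord -[q *+ m]mulr_natl qE; field; rewrite gt_eqF.
    rewrite -/(S w) => h; rewrite mulrC -ler_pdivlMr//.
    have := lt_le_trans xZ h; lra.
apply: le_trans.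
  apply: pr_markov => //.
  - by move=> w; apply: sumr_ge0 => i _; exact: powR_ge0.
  - by rewrite IS ltry.
  - by rewrite mulr_gt0// divr_gt0.
rewrite IS/= q1 le_eqVlt; apply/orP; left; apply/eqP.
have -> : x / 2 = m%:R * q by rewrite qE; field; rewrite gt_eqF.
by field; rewrite ?gt_eqF.
Qed.

End stationary_moments.

(** * Maximal inequality *)

Section block_maximal_inequality.
Context {d : measure_display} {T : measurableType d} {R : realType} (P : probability T R).
Variable eps : nat -> T -> R.
Hypothesis meps : forall k, measurable_fun setT (eps k).
Local Notation pr A := (fine (P A)).
Local Notation W := (blocksum eps).

Lemma blocksumD a k l w : W a (k + l) w = W a k w + W (a + k) l w.
Proof.
rewrite /blocksum big_split_ord/=; congr (_ + _).
by apply: eq_bigr => i _; rewrite addnA.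
Qed.

Lemma blocksum_le_absblock a r m w : (r <= m)%N -> `|W a r w| <= absblock eps a m w.
Proof.
move=> rm; rewrite /absblock -(subnKC rm) big_split_ord/=.
apply: ler_wpDr; first by apply: sumr_ge0.
exact: ler_norm_sum.
Qed.

Lemma sigma_gen_blocksum (I : set nat) a l :
  (forall i, (a < i <= a + l)%N -> I i) ->
  measurable_fun (setT : set (sigma_gen_type eps I))
    (W a l : sigma_gen_type eps I -> R).
Proof.
move=> aI; apply: measurable_sum => i; apply: sigma_gen_measurable_eps.
by apply: aI; rewrite ltnS leq_addr/= -addnS leq_add2l.
Qed.

Let first_passage (m : nat) (x : R) j : set T :=
  [set w | x < `|W 0 (j * m) w|] `&`
  \bigcap_(i in [set i | (i < j)%N]) [set w | `|W 0 (i * m) w| <= x].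

Let sigma_gen_first_passage m x j :
  sigma_gen eps [set i | (1 <= i <= j * m)%N] (first_passage m x j).
Proof.
pose ST := sigma_gen_type eps [set i | (1 <= i <= j * m)%N].
have mW i : (i <= j)%N -> measurable_fun (setT : set ST) (fun w : ST => `|W 0 (i * m) w|).
  move=> ij; apply: measurableT_comp => //; apply: sigma_gen_blocksum => k /=.
  rewrite add0n => /andP[-> /leq_trans]; apply.
  by rewrite leq_mul2r ij orbT.
apply: (@measurableI _ ST).
  by apply: (@measurable_set_ltr _ ST) => //; exact: mW.
apply: (@bigcap_measurableType _ ST) => i /= ij.
by apply: (@measurable_set_ler _ ST) => //; apply: mW; exact: ltnW.
Qed.

Let first_passage_trivIset m x : trivIset setT (first_passage m x).
Proof.
move=> i j _ _ [w [[iw iw'] [jw jw']]].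
have [ij|ji|//] := ltngtP i j.
  by have := jw' i ij => /=; rewrite leNgt iw.
by have := iw' j ji => /=; rewrite leNgt jw.
Qed.

(* An Ottaviani inequality: on the first passage of the block sums above
   [3 x], the sums from the end of the next block on, which are almost
   independent of the past, must exceed [x] in order to bring the total back
   below [x]. *)
Lemma block_maximal_inequality (m N : nat) (x b z : R) : (0 < m)%N -> 0 < x ->
  (forall a l, (l <= N * m)%N -> pr [set w | x <= `|W a l w|] <= b) ->
  (forall a, pr [set w | x < absblock eps a m w] <= z) ->
  pr (\bigcup_(k in [set k | (k <= N * m)%N]) [set w | 4 * x < `|W 0 k w|])
    <= 2 * b + N%:R * (alpha_mix P eps m + z).
Proof.
move=> m0 x0 hb hz.
have mW a l : measurable_fun setT (fun w => `|W a l w|).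
  by apply: measurableT_comp => //; exact: measurable_blocksum.
have mge a l : measurable [set w | x <= `|W a l w|] by exact: measurable_set_ler.
pose E j := first_passage m (3 * x) j.
pose F j := E j `&` [set w | x <= `|W (j.+1 * m) ((N - j.+1) * m) w|].
pose Z j := [set w | x < absblock eps (j * m) m w].
have mE j : measurable (E j).
  exact: sigma_gen_measurable meps _ _ (sigma_gen_first_passage m (3 * x) j).
have mF j : measurable (F j) by exact: measurableI.
have mZ j : measurable (Z j).
  by apply: measurable_set_ltr => //; exact: measurable_absblock.
have b0 : 0 <= b by apply: le_trans (hb 0%N 0%N (leq0n _)); exact: pr_ge0.
have sub : \bigcup_(k in [set k | (k <= N * m)%N]) [set w | 4 * x < `|W 0 k w|] `<=`
    [set w | x <= `|W 0 (N * m) w|] `|`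
    (\bigcup_(j < N) F j `|` \bigcup_(j < N) Z j).
  move=> w [k /= kN Wk]; apply: contrapT => /not_orP[WN /not_orP[noF noZ]].
  move/negP: WN; rewrite -ltNge => WN.
  have Zle j : (j < N)%N -> absblock eps (j * m) m w <= x.
    by move=> jN; rewrite leNgt; apply/negP => h; apply: noZ; exists j.
  have step j r : (j < N)%N -> (r <= m)%N ->
      `|W 0 (j * m) w| <= `|W 0 (j * m + r) w| + x.
    move=> jN rm; rewrite blocksumD add0n.
    have := blocksum_le_absblock (j * m) _ _ w rm; have := Zle j jN.
    have := lerB_normD (W 0 (j * m) w) (W (j * m) r w); lra.
  have step' j r : (j < N)%N -> (r <= m)%N ->
      `|W 0 (j * m + r) w| <= `|W 0 (j * m) w| + x.
    move=> jN rm; rewrite blocksumD add0n.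
    have := blocksum_le_absblock (j * m) _ _ w rm; have := Zle j jN.
    have := ler_normD (W 0 (j * m) w) (W (j * m) r w); lra.
  (* Going back from [k] to the start of its block costs at most [x]. At k = Nm there is no such
     block, but there the total itself is below [x]. *)
  have [j jN Wj] : exists2 j, (j < N)%N & 3 * x < `|W 0 (j * m) w|.
    move: kN; rewrite leq_eqVlt => /predU1P[kE|kN].
      by move: Wk; rewrite kE; lra.
    have qN : (k %/ m < N)%N by rewrite ltn_divLR.
    exists (k %/ m)%N => //; have rm : (k %% m <= m)%N by rewrite ltnW// ltn_mod.
    by have := step' _ _ qN rm; rewrite -divn_eq; lra.
  have exj : exists j, 3 * x < `|W 0 (j * m) w| by exists j.
  case: (ex_minnP exj) => i Wi imin.
  have iN : (i < N)%N by apply: leq_ltn_trans jN; exact: imin.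
  apply: noF; exists i => //; split.
    split => // l /= li; rewrite leNgt; apply/negP => /imin.
    by rewrite leqNgt li.
  (* The sum is still above [2 * x] at the end of the next block, while the total is below [x]; the
     remaining sum therefore exceeds [x]. *)
  have := step i m iN (leqnn m).
  have NE : (N * m = (i * m + m) + (N - i.+1) * m)%N.
    by rewrite -mulSnr -mulnDl subnKC.
  have := WN; rewrite {1}NE blocksumD add0n => h1 h2.
  rewrite /= mulSnr.
  have := ler_normB (W 0 (i * m + m) w + W (i * m + m) ((N - i.+1) * m) w)
     (W (i * m + m) ((N - i.+1) * m) w).
  rewrite addrK; lra.
have prF j : (j < N)%N -> pr (F j) <= pr (E j) * b + alpha_mix P eps m.
  (* Mixing needs a past of at least one variable; for j = 0 the empty sum cannot exceed the
     level. *)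
  move=> jN; have [->|j0] := posnP j.
    have -> : F 0%N = set0.
      apply/seteqP; split => w //= [[/=]].
      rewrite mul0n /blocksum big_ord0 normr0; lra.
    by rewrite measure0 /= addr_ge0 ?alpha_mix_ge0// mulr_ge0// pr_ge0.
  apply: (@le_trans _ _ (pr (E j) * pr [set w | x <= `|W (j.+1 * m) ((N - j.+1) * m) w|]
      + alpha_mix P eps m)).
    apply: (alpha_mix_bound P eps meps m (j * m)%N).
    - by rewrite muln_gt0 j0.
    - exact: sigma_gen_first_passage.
    - pose ST := sigma_gen_type eps [set i | (j * m + m <= i)%N].
      apply: (@measurable_set_ler _ ST) => //.
      apply: measurableT_comp => //; apply: sigma_gen_blocksum => i /=.
      by rewrite mulSnr => /andP[/ltnW].
  rewrite lerD2r; apply: ler_wpM2l; first exact: pr_ge0.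
  by apply: hb; rewrite leq_mul2r leq_subr orbT.
apply: (le_trans (le_pr P _ _ _ _ sub)).
- by apply: bigcup_measurable => k _; exact: measurable_set_ltr.
- apply: measurableU => //; apply: measurableU; apply: bigcup_measurable => //.
apply: (le_trans (pr_setU_le P _ _ _ _)) => //.
  by apply: measurableU; apply: bigcup_measurable.
rewrite (_ : 2 * b + _ = b + (1 * b + N%:R * alpha_mix P eps m + N%:R * z)); last by ring.
apply: lerD; first exact: hb.
apply: (le_trans (pr_setU_le P _ _ _ _)); [exact: bigcup_measurable..|].
have sumc (c : R) : \sum_(j < N) c = N%:R * c by rewrite sumr_const card_ord mulr_natl.
apply: lerD.
  apply: (le_trans (pr_bigcup_le P _ _ mF)).
  apply: (@le_trans _ _ (\sum_(j < N) (pr (E j) * b + alpha_mix P eps m))).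
    by apply: ler_sum => j _; exact: prF.
  (* The first passages are disjoint, so [b] is paid once and not [N] times. *)
  rewrite big_split/= sumc lerD2r -mulr_suml; apply: ler_wpM2r => //.
  by apply: sum_pr_disjoint_le1 => //; exact: first_passage_trivIset.
apply: (le_trans (pr_bigcup_le P _ _ mZ)).
rewrite -sumc; apply: ler_sum => j _; exact: hz.
Qed.

End block_maximal_inequality.

(** * Decay rate of the mixing coefficients *)

Section real_lemmas.
Context {R : realType}.

Lemma cvg_natpowR_pinfty (g : R) : 0 < g -> (fun n : nat => n%:R `^ g : R) @ \oo --> +oo.
Proof.
move=> g0; apply/cvgryPge => A.
near=> n.
apply: (@le_trans _ _ ((`|A| `^ g^-1) `^ g)).
  by rewrite -powRrM mulVf ?gt_eqF// powRr1// ler_norm.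
apply: ge0_ler_powR; rewrite ?nnegrE ?powR_ge0 ?(ltW g0)//.
by near: n; exact: nbhs_infty_ger.
Unshelve. all: by end_near. Qed.

(** By monotonicity m u(m) is at most u(1) + ... + u(m), hence at most the sum of the series. *)
Lemma nonincreasing_summable_bound (u : nat -> R) : (forall n, 0 <= u n) ->
  (forall m n, (m <= n)%N -> u n <= u m) -> cvgn (series (fun n => u n.+1)) ->
  exists D, forall m, m%:R * u m <= D.
Proof.
move=> u0 ud cu; exists (limn (series (fun n => u n.+1))) => m.
apply: le_trans (nondecreasing_cvgn_le _ cu m); last first.
  apply/nondecreasing_seqP => n; rewrite /series/= big_nat_recr//=.
  by rewrite lerDl.
rewrite /series/= mulr_natl -[X in _ *+ X]subn0 -sumr_const_nat.
by apply: ler_sum_nat => i /andP[_ im]; exact: ud.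
Qed.

End real_lemmas.

Section mixing_rate.
Context {d : measure_display} {T : measurableType d} {R : realType} (P : probability T R).
Variable eps : nat -> T -> R.
Hypothesis meps : forall k, measurable_fun setT (eps k).

(** Summability and monotonicity give alpha(m) <= (D/m)^(1/th). Since r > 2, th < 2(1/2 - 1/p) = (p
    - 2)/p, which leaves a spare negative power m^(-g). *)
Lemma alpha_mix_rate (p r : R) : 2 < r -> r <= p ->
  cvgn (series (fun n => alpha_mix P eps n.+1 `^ (2 * (r^-1 - p^-1)))) ->
  (fun m : nat => m%:R `^ (p / (p - 2)) * alpha_mix P eps m) @ \oo --> (0 : R).
Proof.
move=> r2 rp cs; set th := 2 * (r^-1 - p^-1) in cs.
have r0 : 0 < r by lra.
have p0 : 0 < p by lra.
have th0 : 0 <= th.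
  by rewrite mulr_ge0// subr_ge0 lef_pV2 ?posrE.
have a0 n : 0 <= alpha_mix P eps n by exact: alpha_mix_ge0.
have [D hD] : exists D, forall m, m%:R * (alpha_mix P eps m `^ th) <= D.
  apply: (nonincreasing_summable_bound (fun m => alpha_mix P eps m `^ th)) => //.
    by move=> n; exact: powR_ge0.
  move=> m n mn; apply: ge0_ler_powR; rewrite ?nnegrE//.
  exact: alpha_mix_nonincreasing.
(* If th were 0, every power would be 1, including that of 0, and [hD] would bound all integers by
   [D]. *)
have th_gt0 : 0 < th.
  rewrite lt_neqAle th0 andbT; apply/negP => /eqP th_eq0.
  have := hD (Num.truncn D).+1; rewrite -th_eq0 powRr0 mulr1 leNgt.
  by rewrite -truncn_lt_nat ?ltnSn// (le_trans _ (hD 0%N))// mul0r.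
have D0 : 0 <= D by apply: le_trans (hD 0%N); rewrite mul0r.
have th_lt : th < (p - 2) / p.
  have -> : (p - 2) / p = 2 * (2^-1 - p^-1) by field; rewrite gt_eqF.
  by rewrite ltr_pM2l// ltrD2r ltf_pV2 ?posrE.
set g := th^-1 - p / (p - 2).
have g0 : 0 < g.
  rewrite subr_gt0 -[ltLHS]invrK invf_div ltf_pV2 ?posrE// divr_gt0//; lra.
have bound m : (0 < m)%N ->
    m%:R `^ (p / (p - 2)) * alpha_mix P eps m <= D `^ th^-1 * (m%:R `^ g)^-1.
  move=> m0; have m0' : 0 < m%:R :> R by rewrite ltr0n.
  have : alpha_mix P eps m <= (D / m%:R) `^ th^-1.
    have -> : alpha_mix P eps m = (alpha_mix P eps m `^ th) `^ th^-1.
      by rewrite -powRrM mulfV ?gt_eqF// powRr1.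
    apply: ge0_ler_powR; rewrite ?nnegrE ?powR_ge0 ?invr_ge0 ?divr_ge0//.
    by rewrite /= ler_pdivlMr// mulrC.
  move=> /(ler_wpM2l (powR_ge0 m%:R (p / (p - 2)))) /le_trans; apply.
  rewrite powRM ?invr_ge0// mulrCA; apply: ler_wpM2l; first exact: powR_ge0.
  rewrite -(powR_inv1 (ltW m0')) -powRrM mulN1r -powRN -powRD ?(gt_eqF m0') ?implybT//.
  by rewrite /g opprB addrC.
apply: (@squeeze_cvgr _ _ _ _ (cst 0) (fun m : nat => D `^ th^-1 * (m%:R `^ g)^-1)).
- near=> m; rewrite mulr_ge0 ?powR_ge0//=; apply: bound.
  by near: m; exact: nbhs_infty_gt.
- exact: cvg_cst.
- rewrite -[X in _ --> X](mulr0 (D `^ th^-1)); apply: cvgMl_tmp.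
  apply/(gtr0_cvgV0 (f := fun m : nat => m%:R `^ g)).
    by near=> m; rewrite powR_gt0// ltr0n; near: m; exact: nbhs_infty_gt.
  exact: cvg_natpowR_pinfty.
Unshelve. all: by end_near. Qed.

End mixing_rate.

(** * Tightness of the maximal partial sum *)

Section maximal_partial_sums.
Context {d : measure_display} {T : measurableType d} {R : realType} (P : probability T R).
Variable eps : nat -> T -> R.
Local Notation pr A := (fine (P A)).
Local Notation W := (blocksum eps 0).

Lemma second_moment (X : T -> R) : 'E_P[X]%E = 0%E -> 'V_P[X]%E = 1%E ->
  (\int[P]_w (X w ^+ 2)%:E)%E = 1%E.
Proof.
move=> E0 <-; rewrite /variance unlock E0/= unlock.
by apply: eq_integral => w _; rewrite -[X w]subr0 expr2.
Qed.

Hypothesis assE : AssumptionE P eps.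

(* The block length [m] is the largest for which the moment bound on a block
   still compensates for the number of blocks, [n / m]. *)
Lemma maximal_partial_sum_bound : exists p C : R, [/\ 2 < p,
  (fun m : nat => m%:R `^ (p / (p - 2)) * alpha_mix P eps m) @ \oo --> (0 : R) &
  forall (n m : nat) (a : R), (0 < n)%N -> 8 <= a ->
    m = Num.truncn (n%:R `^ ((p - 2) / (2 * (p - 1))) : R) ->
    pr (\bigcup_(k in [set k | (k <= n)%N]) [set w | a * Num.sqrt n%:R < `|W k w|])
    <= C / a + C * (m%:R `^ (p / (p - 2)) * alpha_mix P eps m)].
Proof.
case: assE => meps [stat [E0 [V1 [[p [r [p2 [mom [r2 [_ [rp cs]]]]]]] [_ [s [cvs _]]]]]]].
have sq k : (1 <= k)%N -> (\int[P]_w (eps k w ^+ 2)%:E)%E = 1%E.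
  by move=> k1; apply: second_moment; [exact: E0|exact: V1].
have [B B0 hB] := pinfty_ex_gt0 (cvg_seq_bounded (cvgP _ cvs)).
have {}hB k : `|\sum_(j < k) fine 'E_P[eps 1 \* eps j.+2]%E| <= B.
  by have := hB k I; rewrite /series/= big_mkord.
have p1 : 1 < p by lra.
have p0 : 0 < p by lra.
set K := fine (\int[P]_w ((`|eps 1 w| `^ p)%:E))%E.
have K0 : 0 <= K by apply: fine_ge0; apply: integral_ge0 => w _; rewrite lee_fin powR_ge0.
set q := (p - 2) / (2 * (p - 1)).
have q0 : 0 < q by rewrite divr_gt0 ?mulr_gt0//; lra.
(* [C1] collects the Chebyshev term and the moment term; [C2] comes from N <= 2n/m and n^q <= 2m. *)
pose C1 := 64 * (1 + 2 * B) + 16 * K.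
pose C2 := 2 * 2 `^ q^-1 : R.
have C10 : 0 <= C1 by rewrite /C1; lra.
have C20 : 0 <= C2 by rewrite /C2 mulr_ge0// powR_ge0.
exists p, (C1 + C2); split => //; first exact: alpha_mix_rate cs.
move=> n m a n0 a8 mE.
have n0' : 0 < n%:R :> R by rewrite ltr0n.
have n1 : 1 <= n%:R :> R by rewrite ler1n.
have nq1 : 1 <= n%:R `^ q :> R by rewrite -[leLHS](powRr0 n%:R) ler_powR// ltW.
have m0 : (0 < m)%N by rewrite mE truncn_gt0.
have m0' : 0 < m%:R :> R by rewrite ltr0n.
have m1 : 1 <= m%:R :> R by rewrite ler1n.
have mnq : m%:R <= n%:R `^ q :> R by rewrite mE truncn_le powR_ge0.
have nqm : n%:R `^ q <= 2 * m%:R :> R.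
  have /andP[_ /ltW] := truncn_itv (powR_ge0 (n%:R : R) q).
  by move=> /le_trans; apply; rewrite -mE -natr1; lra.
have a0 : 0 < a by lra.
have sn0 : 0 < Num.sqrt n%:R :> R by rewrite sqrtr_gt0.
pose x := a * Num.sqrt n%:R / 4.
have x0 : 0 < x by rewrite divr_gt0// mulr_gt0.
(* The additional block ensures n <= Nm, and m <= n keeps Nm <= 2n. *)
pose N := (n %/ m).+1.
have nNm : (n <= N * m)%N by rewrite ltnW// ltn_ceil.
have mn : (m <= n)%N.
  rewrite -(ler_nat R); apply: le_trans mnq _; rewrite -[leRHS]powRr1//.
  apply: ler_powR => //; rewrite /q ler_pdivrMr; lra.
have Nm : (N * m)%:R <= 2 * n%:R :> R.
  rewrite -natrM ler_nat mul2n mulSn -addnn leq_add// leq_trunc_div//.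
have NR : N%:R <= 2 * (n%:R / m%:R) :> R.
  by move: Nm; rewrite natrM mulrA ler_pdivlMr.
have B1 : 0 <= 1 + 2 * B by lra.
have h : pr (\bigcup_(k in [set k | (k <= N * m)%N]) [set w | 4 * x < `|W k w|]) <=
    2 * ((1 + 2 * B) * (N * m)%:R / x ^+ 2) +
    N%:R * (alpha_mix P eps m + K / (x / (2 * m%:R)) `^ p).
  apply: block_maximal_inequality => // [c l lN|c].
    apply: (le_trans (blocksum_chebyshev P eps meps stat sq B hB c l x x0)).
    rewrite ler_pM2r ?invr_gt0 ?exprn_gt0//; apply: ler_wpM2l => //.
    by rewrite ler_nat.
  exact: (absblock_tail P eps meps stat p p1 mom).
have : pr (\bigcup_(k in [set k | (k <= n)%N]) [set w | a * Num.sqrt n%:R < `|W k w|]) <=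
  pr (\bigcup_(k in [set k | (k <= N * m)%N]) [set w | 4 * x < `|W k w|]).
  have mW y : measurable (\bigcup_(k in [set k | (k <= y)%N])
     [set w | a * Num.sqrt n%:R < `|W k w|]).
    apply: bigcup_measurable => k _; apply: measurable_set_ltr => //.
    by apply: measurableT_comp => //; exact: measurable_blocksum.
  have -> : 4 * x = a * Num.sqrt n%:R by rewrite /x; field.
  apply: le_pr => // w [k /= kn kw]; exists k => //=; exact: leq_trans nNm.
move=> /le_trans; apply; apply: le_trans h _.
have t1 : 2 * ((1 + 2 * B) * (N * m)%:R / x ^+ 2) <= 64 * (1 + 2 * B) / a.
  have -> : x ^+ 2 = a ^+ 2 * n%:R / 16.
    by rewrite /x !exprMn sqr_sqrtr ?ltW//; field.
  apply: (@le_trans _ _ (2 * ((1 + 2 * B) * (2 * n%:R) / (a ^+ 2 * n%:R / 16)))).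
    apply: ler_wpM2l => //; rewrite ler_pM2r ?invr_gt0 ?divr_gt0 ?mulr_gt0 ?exprn_gt0//.
    exact: ler_wpM2l.
  have -> : 2 * ((1 + 2 * B) * (2 * n%:R) / (a ^+ 2 * n%:R / 16)) =
      64 * (1 + 2 * B) / a * a^-1 by field; rewrite !gt_eqF.
  rewrite -[leRHS]mulr1; apply: ler_wpM2l; first by rewrite divr_ge0 ?mulr_ge0// ltW.
  rewrite invf_le1//; lra.
have t3 : N%:R * (K / (x / (2 * m%:R)) `^ p) <= 16 * K / a.
  have -> : x / (2 * m%:R) = a / 8 * (Num.sqrt n%:R / m%:R).
    by rewrite /x; field; rewrite gt_eqF.
  rewrite powRM ?divr_ge0 ?sqrtr_ge0 ?(ltW a0)//.
  (* Here a >= 8 is used, to trade the power p for a linear rate. *)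
  have ap : a / 8 <= (a / 8) `^ p.
    rewrite -[leLHS]powRr1; last by rewrite divr_ge0 ?ltW.
    by apply: ler_powR; [rewrite ler_pdivlMr// mul1r|exact: ltW].
  (* The exponent [q] solves q(p - 1) = p/2 - 1, and this inequality is equivalent to n/m <= (sqrt n
     / m)^p. *)
  have mp : m%:R `^ (p - 1) <= n%:R `^ (p / 2 - 1) :> R.
    apply: (@le_trans _ _ ((n%:R `^ q) `^ (p - 1))).
      by apply: ge0_ler_powR; rewrite ?nnegrE ?powR_ge0 ?subr_ge0 ?(ltW p1)// ltW.
    rewrite -powRrM; apply: ler_powR => //.
    have -> : q * (p - 1) = p / 2 - 1; last by [].
    by rewrite /q; field; rewrite subr_eq0 gt_eqF.
  have NS : N%:R <= 2 * (Num.sqrt n%:R / m%:R) `^ p.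
    apply: le_trans NR _; apply: ler_wpM2l => //.
    rewrite powRM ?invr_ge0// ?sqrtr_ge0//.
    rewrite -powR12_sqrt ?ler0n// -powRrM -(powR_inv1 (ltW m0')) -powRrM.
    have nE : n%:R = n%:R `^ (p / 2) * n%:R `^ (1 - p / 2) :> R.
      by rewrite -powRD ?(gt_eqF n0') ?implybT// -[LHS]powRr1 ?ltW//; congr (_ `^ _); ring.
    have -> : 2^-1 * p = p / 2 by rewrite mulrC.
    rewrite [X in X * _ <= _]nE -mulrA; apply: ler_wpM2l; first exact: powR_ge0.
    have -> : -1 * p = -1 + - (p - 1) by ring.
    rewrite [leRHS]powRD ?(gt_eqF m0') ?implybT// [leLHS]mulrC; apply: ler_wpM2l; first exact: powR_ge0.
    have -> : 1 - p / 2 = - (p / 2 - 1) by ring.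
    by rewrite !powRN lef_pV2 ?posrE ?powR_gt0.
  have sp : 0 < (Num.sqrt n%:R / m%:R) `^ p by rewrite powR_gt0// divr_gt0.
  have a8' : 0 < a / 8 by rewrite divr_gt0.
  have ap0 : 0 < (a / 8) `^ p by rewrite powR_gt0.
  apply: (@le_trans _ _ (2 * (Num.sqrt n%:R / m%:R) `^ p *
     (K / ((a / 8) `^ p * (Num.sqrt n%:R / m%:R) `^ p)))).
    by apply: ler_wpM2r => //; rewrite divr_ge0// mulr_ge0 ?ltW.
  have -> : 2 * (Num.sqrt n%:R / m%:R) `^ p *
     (K / ((a / 8) `^ p * (Num.sqrt n%:R / m%:R) `^ p)) = 2 * K * ((a / 8) `^ p)^-1.
    by field; rewrite !gt_eqF.
  have -> : 16 * K / a = 2 * K * (a / 8)^-1 by field; rewrite gt_eqF.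
  by apply: ler_wpM2l; [exact: mulr_ge0|rewrite lef_pV2].
(* Since 1/q = p/(p - 2) + 1, n <= (2m)^(1/q) bounds n/m by a multiple of m^(p/(p-2)). *)
have t2 : N%:R * alpha_mix P eps m <= C2 * (m%:R `^ (p / (p - 2)) * alpha_mix P eps m).
  rewrite mulrA; apply: ler_wpM2r; first exact: alpha_mix_ge0.
  apply: le_trans NR _; rewrite /C2 -mulrA; apply: ler_wpM2l => //.
  rewrite ler_pdivrMr//.
  have -> : 2 `^ q^-1 * m%:R `^ (p / (p - 2)) * m%:R = (2 * m%:R) `^ q^-1.
    rewrite powRM ?ltW// -mulrA; congr (_ * _).
    rewrite -{2}[m%:R]powRr1 ?ltW// -powRD ?(gt_eqF m0') ?implybT//; congr (_ `^ _).
    by rewrite /q; field; rewrite !subr_eq0 !gt_eqF.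
  apply: (@le_trans _ _ ((n%:R `^ q) `^ q^-1)).
    by rewrite -powRrM mulfV ?gt_eqF// powRr1.
  apply: ge0_ler_powR => //; last by rewrite nnegrE mulr_ge0.
    by rewrite invr_ge0 ltW.
  exact: powR_ge0.
have h0 : 0 <= m%:R `^ (p / (p - 2)) * alpha_mix P eps m.
  by rewrite mulr_ge0 ?powR_ge0// alpha_mix_ge0.
rewrite [X in _ + X <= _]mulrDr.
have e1 : C1 / a = 64 * (1 + 2 * B) / a + 16 * K / a by rewrite /C1 mulrDl.
have c2a : 0 <= C2 / a by rewrite divr_ge0// ltW.
have c1h := mulr_ge0 C10 h0.
rewrite 2!(mulrDl C1 C2) e1; lra.
Qed.

(** Tightness is expressed through arbitrary diverging levels; as q > 0, the block length tends to
    infinity and the mixing term vanishes too. *)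
Lemma maximal_partial_sums_tight (a : nat -> R) : a @ \oo --> +oo ->
  (fun n => pr (\bigcup_(k in [set k | (k <= n)%N])
     [set w | a n * Num.sqrt n%:R < `|W k w|])) @ \oo --> (0 : R).
Proof.
move=> ay; have [p [C [p2 ha hb]]] := maximal_partial_sum_bound.
set q := (p - 2) / (2 * (p - 1)) in hb.
have q0 : 0 < q by rewrite divr_gt0 ?mulr_gt0//; lra.
pose h (m : nat) := m%:R `^ (p / (p - 2)) * alpha_mix P eps m.
apply: (@squeeze_cvgr _ _ _ _ (cst 0)
  (fun n => C * (a n)^-1 + C * h (Num.truncn (n%:R `^ q)))).
- near=> n; rewrite pr_ge0/=; apply: hb => //.
    by near: n; exact: nbhs_infty_gt.
  by near: n; move/cvgryPge : ay; exact.
- exact: cvg_cst.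
- rewrite -[X in _ --> X](_ : C * 0 + C * 0 = 0); last by rewrite !mulr0 addr0.
  apply: cvgD; apply: cvgMl_tmp.
    apply/(gtr0_cvgV0 (f := a)) => //.
    near=> n; apply: (@lt_le_trans _ _ 1) => //.
    by near: n; move/cvgryPge : ay; exact.
  apply: (@cvg_comp _ _ _ (fun n : nat => Num.truncn (n%:R `^ q : R)) h _ _ _ _ ha).
  apply/cvgnyPge => A; near=> n; rewrite truncn_ge_nat ?powR_ge0//.
  by near: n; move/cvgryPge : (cvg_natpowR_pinfty q q0); exact.
Unshelve. all: by end_near. Qed.

End maximal_partial_sums.

(** * Deterministic lower bounds for both statistics *)

(** The noise level kappa sqrt(a) sqrt n may grow, yet stays below the drift, of order a sqrt n. The
    conditions on [n] and [a] give, in order: tau >= n zeta/2; a >= 1; kappa sqrt(a) >= 1; room for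
    the window of R before [n]. *)
Lemma statistics_large {R : realType} (mu dl zeta M : R) (n : nat) (y : nat -> R) :
  0 < zeta < 1 -> 0 <= M ->
  let c := zeta * (1 - zeta) / 2 in
  let kappa := c / (20 * (M + 1)) in
  let a := `|dl| * Num.sqrt n%:R in
  let tau := Num.truncn (n%:R * zeta) in
  let Y := fun k => mu + dl * (tau < k)%N%:R + y k in
  2 / zeta <= n%:R -> 1 <= a -> kappa ^- 2 <= a -> 2 / (1 - zeta) <= a ->
  (forall k, (1 <= k <= n)%N ->
    `|\sum_(1 <= i < k.+1) y i| <= kappa * Num.sqrt a * Num.sqrt n%:R) ->
  (exists2 i, (1 <= i <= tau)%N & y i != y 1%N) ->
  M < Qstat Y n /\ M < Rstat Y n.
Proof.
move=> /andP[z0 z1] M0 c kappa a tau Y nz a1 ak az SA nd.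
have z1' : 0 < 1 - zeta by lra.
have c0 : 0 < c by rewrite /c divr_gt0// mulr_gt0.
have M1 : 0 < M + 1 by lra.
have k0 : 0 < kappa by rewrite /kappa divr_gt0// mulr_gt0.
have kE : kappa * (20 * (M + 1)) = c by rewrite /kappa; field; rewrite gt_eqF.
have n0' : 0 < n%:R :> R by apply: lt_le_trans nz; rewrite divr_gt0.
have n0 : (0 < n)%N by rewrite -(ltr0n R).
set s := Num.sqrt n%:R in a a1 ak az SA.
have s0 : 0 < s by rewrite sqrtr_gt0.
have ss : n%:R = s ^+ 2 by rewrite sqr_sqrtr// ltW.
have a0 : 0 < a by lra.
have d0 : 0 < `|dl| by rewrite -(pmulr_lgt0 _ s0).
set u := Num.sqrt a in SA.
have u0 : 0 < u by rewrite sqrtr_gt0.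
have uu : a = u ^+ 2 by rewrite sqr_sqrtr// ltW.
have u1 : 1 <= u by rewrite -(@ler_pXn2r _ 2)// ?nnegrE ?expr1n -?uu//; exact: ltW.
have ku : 1 <= kappa * u.
  have ku0 : 0 <= kappa * u by rewrite mulr_ge0// ltW.
  rewrite -(@ler_pXn2r _ 2)// ?nnegrE// expr1n exprMn -uu mulrC.
  by rewrite -ler_pdivrMr ?exprn_gt0// mul1r.
have zn0 : 0 <= n%:R * zeta by rewrite mulr_ge0 ?ltW.
have /andP[tau_le tau_gt] := truncn_itv zn0; rewrite -/tau in tau_le tau_gt.
have zn2 : 2 <= n%:R * zeta by rewrite -ler_pdivrMr.
have taur : n%:R * zeta / 2 <= tau%:R :> R by move: tau_gt; rewrite -natr1; lra.
have tau1 : (1 <= tau)%N by rewrite -(ler_nat R); lra.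
have taun : (tau < n)%N.
  rewrite -(ltr_nat R); apply: le_lt_trans tau_le _.
  by rewrite -[ltRHS]mulr1 ltr_pM2l.
have tau1n : (1 <= tau < n)%N by rewrite tau1.
have A0 : 0 <= kappa * u * s by apply: mulr_ge0; [apply: mulr_ge0|]; exact: ltW.
have as_ : `|dl| * n%:R = a * s by rewrite ss /a; ring.
have drift k : (tau <= k)%N -> (k <= n)%N -> forall t, 0 <= t ->
    t * n%:R <= (n - k)%N%:R -> a * s * (zeta / 2 * t) <= `|dl| * (tau%:R * (n - k)%N%:R / n%:R).
  move=> tk kn t t0 ht.
  rewrite -as_ -mulrA; apply: ler_wpM2l => //.
  rewrite ler_pdivlMr//.
  have -> : n%:R * (zeta / 2 * t) * n%:R = (n%:R * zeta / 2) * (t * n%:R) by ring.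
  by apply: ler_pM => //; rewrite ?divr_ge0// mulr_ge0// ltW.
have ks : kappa * u * s * (20 * (M + 1)) <= a * s * c.
  have -> : kappa * u * s * (20 * (M + 1)) = (kappa * (20 * (M + 1))) * (u * s) by ring.
  rewrite kE mulrC uu; apply: ler_wpM2r; first exact: ltW.
  by rewrite expr2 -mulrA -[leLHS]mul1r; apply: ler_wpM2r => //; rewrite mulr_ge0 ?ltW.
have as0 : 0 < a * s by exact: mulr_gt0.
have asc0 : 0 < a * s * c by exact: mulr_gt0.
have kM : 0 <= kappa * u * s * M by exact: mulr_ge0.
split.
  apply: (Qstat_gt mu dl tau n y _ SA tau1n nd M M0).
  apply: (@lt_le_trans _ _ (a * s * (zeta / 2 * (1 - zeta)))); last first.
    apply: (drift tau (leqnn _) (ltnW taun)); first exact: ltW.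
  by rewrite natrB ?(ltnW taun)//; lra.
  have -> : zeta / 2 * (1 - zeta) = c by rewrite /c; ring.
  lra.
(* This is the longest window whose displaced drift |dl| J stays within sqrt n. *)
pose J := Num.truncn (s / `|dl|).
have sd0 : 0 <= s / `|dl| by rewrite divr_ge0// ltW.
have /andP[J_le J_gt] := truncn_itv sd0; rewrite -/J in J_le J_gt.
have sdE : s / `|dl| = n%:R / a by rewrite ss /a; field; rewrite !gt_eqF.
have Jn : J%:R <= n%:R * (1 - zeta) / 2 :> R.
  apply: le_trans J_le _; rewrite sdE ler_pdivrMr//.
  have : 2 <= a * (1 - zeta) by rewrite -ler_pdivrMr.
  by move=> h; rewrite -[leLHS]mulr1; nra.
have tJ : (tau + J < n)%N.
  rewrite -(ltr_nat R) natrD.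
  have : 0 < n%:R * (1 - zeta) by exact: mulr_gt0.
  lra.
pose b := a * s * c / 4.
have b0 : 0 <= b by rewrite /b divr_ge0// ltW.
have JE : `|dl| * J%:R <= s by rewrite mulrC -ler_pdivlMr.
have hb k : (tau <= k <= tau + J)%N ->
    b + 2 * (kappa * u * s) <= `|dl| * (tau%:R * (n - k)%N%:R / n%:R).
  move=> /andP[tk kJ]; have kn := leq_trans kJ (ltnW tJ).
  apply: (@le_trans _ _ (a * s * (zeta / 2 * ((1 - zeta) / 2)))).
    have -> : zeta / 2 * ((1 - zeta) / 2) = c / 2 by rewrite /c; field.
    rewrite /b; lra.
  apply: drift => //; first by rewrite divr_ge0 ?ltW.
  have kJ' : k%:R <= tau%:R + J%:R :> R by rewrite -natrD ler_nat.
  rewrite natrB//; lra.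
apply: lt_le_trans (Rstat_ge mu dl tau n y _ SA tau1n nd J b s tJ b0 JE hb).
(* The drift allowance [s] is absorbed by the noise level because kappa u >= 1. *)
have den_le : n%:R * (4 * (kappa * u * s) + s) ^+ 2 <= n%:R * (s * (5 * (kappa * u))) ^+ 2.
  have ge1 : 0 <= 4 * (kappa * u * s) + s by lra.
  have ge2 : 0 <= s * (5 * (kappa * u)).
    by apply: mulr_ge0; [exact: ltW|lra].
  have le1 : 0 <= s * (kappa * u - 1) by apply: mulr_ge0; [exact: ltW|lra].
  by apply: ler_wpM2l => //; rewrite ler_pXn2r ?nnegrE//; lra.
have den0 : 0 < n%:R * (4 * (kappa * u * s) + s) ^+ 2.
  by rewrite mulr_gt0// exprn_gt0// ltr_wpDl// mulr_ge0.
(* With J + 1 >= n/a all powers of [a] and [n] cancel, leaving (c/(20 kappa))^2 = (M + 1)^2; this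
   dictates the choice of [kappa]. *)
apply: (@lt_le_trans _ _ (n%:R / a * (b ^+ 2 / (n%:R * (s * (5 * (kappa * u))) ^+ 2)))).
  have -> : n%:R / a * (b ^+ 2 / (n%:R * (s * (5 * (kappa * u))) ^+ 2)) = (c / (20 * kappa)) ^+ 2.
    by rewrite /b uu ss; field; rewrite !gt_eqF.
  have -> : c / (20 * kappa) = M + 1 by rewrite -kE; field; rewrite gt_eqF.
  nra.
apply: ler_pM.
- by rewrite divr_ge0 ?ltW.
- by rewrite divr_ge0 ?sqr_ge0// mulr_ge0 ?sqr_ge0.
- by rewrite -sdE ltW.
- apply: ler_wpM2l; first exact: sqr_ge0.
  by rewrite lef_pV2 ?posrE//; exact: lt_le_trans den_le.
Qed.

(** * Nondegeneracy *)

Section nondegeneracy.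
Context {d : measure_display} {T : measurableType d} {R : realType} (P : probability T R).
Variable eps : nat -> T -> R.
Local Notation pr A := (fine (P A)).

(** An almost surely nonnegative variable of mean zero vanishes almost surely, against its second
    moment 1. *)
Lemma pr_ge0_lt1 (X : T -> R) : measurable_fun setT X ->
  'E_P[X]%E = 0%E -> (\int[P]_w (X w ^+ 2)%:E)%E = 1%E -> pr [set w | 0 <= X w] < 1.
Proof.
move=> mX E0 E2.
have mA : measurable [set w | 0 <= X w] by exact: measurable_set_ler.
rewrite lt_neqAle pr_le1// andbT; apply/negP => /eqP prA.
have X0 : {ae P, forall w, 0 <= X w}.
  rewrite /prop_near1 /= /almost_everywhere/=.
  apply/negligibleP; first exact: measurableC.
  apply: eq_trans (probability_setC P mA) _.
  by rewrite pr_EFin// prA subee.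
have mXE : measurable_fun setT (EFin \o X) by exact/measurable_EFinP.
have absX : (\int[P]_w `|(X w)%:E| = 0)%E.
  rewrite -E0 unlock; apply: ae_eq_integral => //; first exact: measurableT_comp.
  by apply: filterS X0 => w Xw _ /=; rewrite ger0_norm.
have /(ae_eq_integral_abs P measurableT mXE) Xae := absX.
suff : (\int[P]_w (X w ^+ 2)%:E = 0)%E by rewrite E2 => /eqP; rewrite eqe oner_eq0.
rewrite -[RHS](integral0 P setT); apply: ae_eq_integral => //.
  by apply/measurable_EFinP; exact: measurable_funX.
by apply: filterS Xae => w /(_ I)/= [->]; rewrite expr0n.
Qed.

Hypothesis assE : AssumptionE P eps.

Let meps : forall k, measurable_fun setT (eps k) := assE.1.

Lemma alpha_mix_cvg0 : (fun m => alpha_mix P eps m.+1) @ \oo --> (0 : R).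
Proof.
case: assE => _ [_ [_ [_ [_ [cs _]]]]].
apply: (@squeeze_cvgr _ _ _ _ (cst 0) (fun n => n.+1%:R * alpha_mix P eps n.+1)).
- near=> n; rewrite /= alpha_mix_ge0//= -[leLHS]mul1r ler_wpM2r ?alpha_mix_ge0//.
  by rewrite ler1n.
- exact: cvg_cst.
- exact: cvg_series_cvg_0.
Unshelve. all: by end_near. Qed.

Let run (B : set R) m k := \bigcap_(j in [set j | (j <= k)%N]) (eps (j * m).+1 @^-1` B).

Let sigma_gen_run B m k : measurable B ->
  sigma_gen eps [set i | (1 <= i <= (k * m).+1)%N] (run B m k).
Proof.
move=> mB; pose ST := sigma_gen_type eps [set i | (1 <= i <= (k * m).+1)%N].
apply: (@bigcap_measurableType _ ST) => j /= jk.
rewrite -[X in measurable X]setTI; apply: sigma_gen_measurable_eps => //=.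
by rewrite ltnS leq_mul2r jk orbT.
Qed.

Let pr_eps (B : set R) k : measurable B -> pr (eps k.+1 @^-1` B) = pr (eps 1 @^-1` B).
Proof.
move=> mB; have := stationary_pair P eps assE.2.1 k 0 setT B measurableT mB.
by rewrite !preimage_setT !setTI !add0n add1n => ->.
Qed.

(** Each further variable, at distance [m] from the preceding ones, contributes a factor at the cost
    of one mixing coefficient. *)
Let pr_run (B : set R) m k : measurable B ->
  pr (run B m k) <= pr (eps 1 @^-1` B) ^+ k.+1 + k%:R * alpha_mix P eps m.
Proof.
move=> mB.
have mrun j : measurable (run B m j).
  exact: sigma_gen_measurable meps _ _ (sigma_gen_run B m j mB).
have me j : measurable (eps j @^-1` B) by rewrite -[X in measurable X]setTI; exact: meps.
elim: k => [|k IH].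
  rewrite expr1 mul0r addr0; apply: le_pr => // w h; exact: (h 0%N).
have -> : run B m k.+1 = run B m k `&` eps (k.+1 * m).+1 @^-1` B.
  apply/seteqP; split => w /=.
    move=> h; split; last exact: (h _ (leqnn _)).
    by move=> j /= jk; apply: h => /=; exact: leqW.
  by move=> [h hk] j /=; rewrite leq_eqVlt => /predU1P[->//|]; exact: h.
apply: (le_trans (alpha_mix_bound P eps meps m (k * m).+1 _ _ _ _ _)) => //.
- exact: sigma_gen_run.
- rewrite -[X in sigma_gen _ _ X]setTI.
  have : ([set i | ((k * m).+1 + m <= i)%N]) (k.+1 * m).+1 by rewrite /= mulSnr.
  by move=> /(@sigma_gen_measurable_eps _ _ _ eps); apply.
rewrite pr_eps// exprSr -natr1 mulrDl mul1r addrA lerD2r.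
apply: le_trans (ler_wpM2r (pr_ge0 P _) IH) _.
rewrite mulrDl lerD2l -[leRHS]mulr1; apply: ler_wpM2l; last exact: pr_le1.
by rewrite mulr_ge0// alpha_mix_ge0.
Qed.

(* Among variables far apart, hence almost independent, a common event of
   probability less than one occurs at all times with vanishing probability. *)
Lemma cvg_pr_run (B : set R) : measurable B -> pr (eps 1 @^-1` B) < 1 ->
  (fun t => pr (\bigcap_(i in [set i | (1 <= i <= t)%N]) (eps i @^-1` B))) @ \oo --> (0 : R).
Proof.
move=> mB q1; set q := pr _ in q1.
have q0 : 0 <= q by exact: pr_ge0.
have me j : measurable (eps j @^-1` B) by rewrite -[X in measurable X]setTI; exact: meps.
apply/cvgr0Pnorm_lt => e e0.
have e20 : 0 < e / 2 by rewrite divr_gt0.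
have qn : `|q| < 1 by rewrite ger0_norm.
(* The number of variables is fixed first, to make the power small; their spacing is chosen
   afterwards, to make [K] mixing coefficients small. *)
have [K _ hK] := (cvgr0Pnorm_lt _).1 (cvg_expr qn) _ e20.
have {}hK : q ^+ K.+1 < e / 2.
  by have := hK K.+1 (leqnSn K); apply: le_lt_trans; exact: ler_norm.
have e2K : 0 < e / 2 / K.+1%:R by rewrite divr_gt0.
have [m _ hm] := (cvgr0Pnorm_lt _).1 alpha_mix_cvg0 _ e2K.
have {}hm : K%:R * alpha_mix P eps m.+1 <= e / 2.
  have := hm m (leqnn m); rewrite ger0_norm ?alpha_mix_ge0// ltr_pdivlMr// mulrC.
  move=> /ltW; apply: le_trans; apply: ler_wpM2r; first exact: alpha_mix_ge0.
  by rewrite ler_nat.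
near=> t.
rewrite ger0_norm ?pr_ge0//.
apply: (@le_lt_trans _ _ (pr (run B m.+1 K))).
  apply: le_pr.
  - by apply: bigcap_measurableType => j _.
  - by apply: bigcap_measurableType => j _.
  - move=> w h j /= jK; apply: h => /=.
    apply: (@leq_trans (K * m.+1).+1); first by rewrite ltnS leq_mul2r jK orbT.
    near: t; exact: nbhs_infty_ge.
apply: le_lt_trans (pr_run B m.+1 K mB) _; rewrite -/q; lra.
Unshelve. all: by end_near. Qed.

Lemma sign_not_constant :
  pr (eps 1 @^-1` `]0, +oo[%classic) < 1 /\ pr (eps 1 @^-1` `]-oo, 0]%classic) < 1.
Proof.
case: assE => _ [_ [E0 [V1 _]]].
have sq := second_moment P _ (E0 1%N isT) (V1 1%N isT).
have me (B : set R) : measurable B -> measurable (eps 1 @^-1` B).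
  by move=> mB; rewrite -[X in measurable X]setTI; exact: meps.
split.
  have h := pr_ge0_lt1 (eps 1) (meps 1) (E0 1%N isT) sq.
  apply: le_lt_trans h.
  apply: le_pr; [exact: me|exact: measurable_set_ler|].
  by move=> w /=; rewrite in_itv/= andbT => /ltW.
have mN : measurable_fun setT (fun w => - eps 1 w) by exact: measurableT_comp.
apply: le_lt_trans (pr_ge0_lt1 (fun w => - eps 1 w) mN _ _).
- apply: le_pr; [exact: me|exact: measurable_set_ler|].
  by move=> w /=; rewrite in_itv/= oppr_ge0.
- have ieps : P.-integrable setT (EFin \o eps 1).
    have isq : P.-integrable setT (fun w => (eps 1 w ^+ 2)%:E).
      apply/integrableP; split; first by apply/measurable_EFinP; exact: measurable_funX.
      by under eq_integral do rewrite /= ger0_norm ?sqr_ge0//; rewrite sq ltry.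
    have i1 : P.-integrable setT (cst 1%E).
      by apply/finite_measure_integrable_cst.
    apply: (le_integrable measurableT _ _ (integrableD measurableT i1 isq)).
      exact/measurable_EFinP.
    move=> w _ /=; rewrite lee_fin [leRHS]ger0_norm ?addr_ge0 ?sqr_ge0//.
    by rewrite ler_norml; apply/andP; split; nra.
  rewrite unlock; under eq_integral => w _ do rewrite -mulN1r EFinM.
  rewrite integralZl//.
  by have := E0 1%N isT; rewrite unlock => ->; rewrite mule0.
- by under eq_integral do rewrite sqrrN.
Qed.

End nondegeneracy.

(** * Measurability of the statistics *)

Section measurable_statistics.
Context {d : measure_display} {T : measurableType d} {R : realType}.
Variables (Y : nat -> T -> R) (n : nat).
Hypothesis mY : forall k, measurable_fun setT (Y k).

Let mV k : measurable_fun setT (fun w => Vn (Y ^~ w) k).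
Proof. by apply: measurable_sum_seq => i _; exact: mY. Qed.

Let mVt k : measurable_fun setT (fun w => Vtn (Y ^~ w) n k).
Proof. exact: measurable_funB. Qed.

Let mbridge (a : R) (f g : T -> R) : measurable_fun setT f -> measurable_fun setT g ->
  measurable_fun setT (fun w => f w - a * g w).
Proof.
by move=> mf mg; apply: measurable_funB => //; apply: measurable_funM.
Qed.

Lemma measurable_Qstat : measurable_fun setT (fun w => Qstat (Y ^~ w) n).
Proof.
apply: measurable_bigmax => k _; apply: measurableT_comp => //.
apply: measurable_div_ge0; first exact: mbridge.
- by apply: measurable_funD; apply: measurable_bigmax => i _;
    apply: measurableT_comp => //; exact: mbridge.
- by move=> w; rewrite addr_ge0// bigmax_ge_id.
Qed.

Lemma measurable_Rstat : measurable_fun setT (fun w => Rstat (Y ^~ w) n).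
Proof.
apply: measurable_sum_seq => k _.
apply: measurable_div_ge0; first by apply: measurable_funX; exact: mbridge.
- by apply: measurable_funD; apply: measurable_sum_seq => i _;
    apply: measurable_funX; exact: mbridge.
- by move=> w; rewrite addr_ge0// sumr_ge0// => i _; exact: sqr_ge0.
Qed.

End measurable_statistics.

(** * Divergence in probability *)

Lemma cvg_prob_infty_pr {d : measure_display} {T : measurableType d} {R : realType}
    (P : probability T R) (X : nat -> T -> R) :
  (forall n, measurable_fun setT (X n)) ->
  (forall M, 0 <= M -> (fun n => fine (P [set w | X n w <= M])) @ \oo --> (0 : R)) ->
  cvg_prob_infty P X.
Proof.
move=> mX h M.
have mA n (c : R) : measurable [set w | X n w <= c] by exact: measurable_set_ler.
apply/fine_cvgP; split.
  by near=> n; rewrite fin_num_measure.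
apply: (@squeeze_cvgr _ _ _ _ (cst 0) (fun n => fine (P [set w | X n w <= `|M|]))).
- near=> n; rewrite /= pr_ge0/=; apply: le_pr => // w /= /le_trans; apply.
  exact: ler_norm.
- exact: cvg_cst.
- exact: h.
Unshelve. all: by end_near. Qed.

Theorem theorem2 (d : measure_display) (T : measurableType d) (R : realType)
  (P : probability T R) (eps : nat -> T -> R) (sig : R -> R)
  (mu : R) (delta : nat -> R) (zeta : R) :
  AssumptionE P eps -> AssumptionV sig -> AssumptionC delta ->
  0 < zeta < 1 ->
  (forall n, delta n != 0) ->
  let tau := fun n : nat => Num.truncn (n%:R * zeta) in
  let Y := fun n k w => Ymodel mu delta tau sig eps n k w in
  cvg_prob_infty P (fun n w => Qstat (fun k => Y n k w) n) /\
  cvg_prob_infty P (fun n w => Rstat (fun k => Y n k w) n).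
Proof.
move=> aE aV aC zeta01 _ tau Y.
have meps : forall k, measurable_fun setT (eps k) by case: aE.
have mY n k : measurable_fun setT (Y n k).
  by apply: measurable_funD => //; exact: measurable_funM.
have [C C0 hC] := AssumptionV_weighted_sums sig aV.
have sig0 : forall x, 0 <= x <= 1 -> 0 < sig x by case: aV.
pose run (B : set R) t := \bigcap_(i in [set i | (1 <= i <= t)%N]) (eps i @^-1` B).
pose pos : set R := `]0, +oo[%classic.
pose neg : set R := `]-oo, 0]%classic.
pose a n := `|delta n| * Num.sqrt n%:R.
have mrun B t : measurable B -> measurable (run B t).
  move=> mB; apply: bigcap_measurableType => j _.
  by rewrite -[X in measurable X]setTI; exact: meps.
have mpos t : measurable (run pos t) by apply: mrun; exact: measurable_itv.
have mneg t : measurable (run neg t) by apply: mrun; exact: measurable_itv.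
have /andP[z0 z1] := zeta01.
have tau_cvg : tau @ \oo --> \oo.
  apply/cvgnyPge => A; near=> n.
  rewrite truncn_ge_nat; last by rewrite mulr_ge0// ltW.
  rewrite -ler_pdivrMr//.
  by near: n; exact: nbhs_infty_ger.
have [posl negl] := sign_not_constant P eps aE.
have run_pos : (fun n => fine (P (run pos (tau n)))) @ \oo --> (0 : R).
  apply: (@cvg_comp _ _ _ tau (fun t => fine (P (run pos t))) _ _ _ tau_cvg).
  exact: (cvg_pr_run P eps aE pos (measurable_itv _) posl).
have run_neg : (fun n => fine (P (run neg (tau n)))) @ \oo --> (0 : R).
  apply: (@cvg_comp _ _ _ tau (fun t => fine (P (run neg t))) _ _ _ tau_cvg).
  exact: (cvg_pr_run P eps aE neg (measurable_itv _) negl).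
(* One exceptional event of vanishing probability serves both statistics. *)
suff main M : 0 <= M -> exists2 Bad : nat -> set T,
    (forall n, measurable (Bad n)) /\ (fun n => fine (P (Bad n))) @ \oo --> (0 : R) &
    \forall n \near \oo, forall w, ~ Bad n w ->
      M < Qstat (fun k => Y n k w) n /\ M < Rstat (fun k => Y n k w) n.
  have squeeze (X : nat -> T -> R) (M : R) (Bad : nat -> set T) :
      (forall n, measurable_fun setT (X n)) -> (forall n, measurable (Bad n)) ->
      (fun n => fine (P (Bad n))) @ \oo --> (0 : R) ->
      (\forall n \near \oo, forall w, ~ Bad n w -> M < X n w) ->
      (fun n => fine (P [set w | X n w <= M])) @ \oo --> (0 : R).
    move=> mX mBad Bad0 hBad.
    apply: (@squeeze_cvgr _ _ _ _ (cst 0) (fun n => fine (P (Bad n)))) => //.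
      near=> n; rewrite /= pr_ge0/=; apply: le_pr => //.
        exact: measurable_set_ler.
      move=> w /= XM; apply: contrapT => nB.
      have : forall w, ~ Bad n w -> M < X n w by near: n.
      by move=> /(_ w nB); rewrite ltNge XM.
    exact: cvg_cst.
  split; apply: cvg_prob_infty_pr => [n|M M0].
  - exact: measurable_Qstat.
  - have [Bad [mBad Bad0] hBad] := main M M0.
    apply: (squeeze _ _ Bad) => // [n|]; first exact: measurable_Qstat.
    by apply: filterS hBad => n h w /h[].
  - exact: measurable_Rstat.
  - have [Bad [mBad Bad0] hBad] := main M M0.
    apply: (squeeze _ _ Bad) => // [n|]; first exact: measurable_Rstat.
    by apply: filterS hBad => n h w /h[].
move=> M0.
pose kappa := zeta * (1 - zeta) / 2 / (20 * (M + 1)).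
have k0 : 0 < kappa.
  by rewrite /kappa !divr_gt0 ?mulr_gt0 ?subr_gt0//; lra.
(* Division by [C] turns the level required for the weighted sums into one for the sums of [eps]; it
   still diverges. *)
pose b n := kappa * Num.sqrt (a n) / C.
pose Big n := \bigcup_(k in [set k | (k <= n)%N])
  [set w | b n * Num.sqrt n%:R < `|blocksum eps 0 k w|].
have mBig n : measurable (Big n).
  apply: bigcup_measurable => k _; apply: measurable_set_ltr => //.
  by apply: measurableT_comp => //; exact: measurable_blocksum.
have a_big x : \forall n \near \oo, x <= a n by move/cvgryPge : aC; exact.
have b_cvg : b @ \oo --> +oo.
  apply/cvgryPge => A; near=> n.
  rewrite /b ler_pdivlMr// mulrC -ler_pdivrMl//.
  apply: (le_trans (ler_norm _)); rewrite -sqrtr_sqr; apply: ler_wsqrtr.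
  by near: n; exact: a_big.
have Big0 : (fun n => fine (P (Big n))) @ \oo --> (0 : R).
  exact: maximal_partial_sums_tight.
exists (fun n => Big n `|` (run pos (tau n) `|` run neg (tau n))).
  split; first by move=> n; apply: measurableU => //; exact: measurableU.
  apply: (@squeeze_cvgr _ _ _ _ (cst 0) (fun n => fine (P (Big n)) +
      (fine (P (run pos (tau n))) + fine (P (run neg (tau n)))))).
  - near=> n; rewrite /= pr_ge0/=.
    apply: (le_trans (pr_setU_le P _ _ _ _)) => //.
      exact: measurableU.
    by rewrite lerD2l; exact: pr_setU_le.
  - exact: cvg_cst.
  - rewrite -[X in _ --> X](_ : 0 + (0 + 0) = 0); last by rewrite !addr0.
    by apply: cvgD => //; exact: cvgD.
near=> n => w /not_orP[nBig /not_orP[npos nneg]].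
have a1 : 1 <= a n by near: n; exact: a_big.
have n0 : (0 < n)%N by near: n; exact: nbhs_infty_gt.
have n0' : 0 < n%:R :> R by rewrite ltr0n.
apply: (statistics_large mu (delta n) zeta M n (fun k => sig (k%:R / n%:R) * eps k w)) => //.
- by near: n; exact: nbhs_infty_ger.
- by near: n; exact: a_big.
- by near: n; exact: a_big.
- move=> k kn; rewrite -[X in _ <= X]/(kappa * Num.sqrt (a n) * Num.sqrt n%:R).
  have -> : kappa * Num.sqrt (a n) * Num.sqrt n%:R = C * (b n * Num.sqrt n%:R).
    by rewrite /b; field; rewrite gt_eqF.
  apply: hC => // j /andP[_ jn]; rewrite leNgt; apply/negP => h.
  apply: nBig; exists j => //=.
  by rewrite /blocksum; move: h; rewrite big_add1 big_mkord.
(* If the weighted innovations up to [tau n] all coincide, positivity of [sig] gives each [eps i]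
   the sign of [eps 1], which puts [w] in one of the two runs. *)
- apply: contrapT => deg.
  have degE i : (1 <= i <= tau n)%N ->
      sig (i%:R / n%:R) * eps i w = sig (1 / n%:R) * eps 1 w.
    by move=> it; apply: contrapT => /eqP h; apply: deg; exists i.
  have tn : (tau n <= n)%N.
    rewrite -(ler_nat R); apply: le_trans (_ : n%:R * zeta <= _).
      by rewrite truncn_le mulr_ge0// ltW.
    by rewrite -[leRHS]mulr1 ler_wpM2l// ltW.
  have sigi i : (1 <= i <= tau n)%N -> 0 < sig (i%:R / n%:R).
    move=> /andP[_ it]; apply: sig0; rewrite divr_ge0//= ler_pdivrMr// mul1r ler_nat.
    exact: leq_trans tn.
  have sig1 : 0 < sig (1 / n%:R).
    by apply: sig0; rewrite divr_ge0//= ler_pdivrMr// mul1r ler1n.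
  have [e0|e0] := ltP 0 (eps 1 w).
    apply: npos => i it; rewrite /pos /= in_itv/= andbT.
    by rewrite -(pmulr_rgt0 _ (sigi i it)) degE// pmulr_rgt0.
  apply: nneg => i it; rewrite /neg /= in_itv/=.
  by rewrite -(pmulr_rle0 _ (sigi i it)) degE// pmulr_rle0.
Unshelve. all: by end_near. Qed.
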